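(* Fix $I,\underline I>0$. Consider a sequence of smooth full characteristic initial data sets for the Einstein vacuum equations on $H_0=\{0\}\times[0,\underline I]\times\mathbb S^2$ and $\underline H_0=[0,I]\times\{0\}\times\mathbb S^2$, with $b_n=0$ on $\underline H_0$, obeying the bounds (UB) of the context with $D_0$ and $\mathring\gamma$ independent of $n$, and such that $\gamma_n\restriction_{S_{0,0}}$ converges in $C^3$ to a limit metric. Let $g_n$ be the corresponding vacuum solutions in double null coordinates on a common domain $\mathcal M=[0,u_*]\times[0,\underline u_*]\times\mathbb S^2$ (with $u_*\in(0,I]$ and $\underline u_*>0$ sufficiently small), let $g_{n_k}$ be a subsequence converging to $g_\infty$ in $C^0$ and weakly in $W^{1,2}$, with Ricci coefficients converging weakly in $L^2$ to those of $g_\infty$, and such that the weak-* limits $$d\nu_u=\text{weak-*}\lim_{k\to\infty}\big(\Omega_{n_k}^2|\hat\chi_{n_k}|^2_{\gamma_{n_k}}dA_{\gamma_{n_k}}d\underline u-\Omega_\infty^2|\hat\chi_\infty|^2_{\gamma_\infty}dA_{\gamma_\infty}d\underline u\big)\ \text{ on }\{u\}\times(0,\underline u_* )\times\mathbb S^2,$$ $$d\underline\nu_{\underline u}=\text{weak-*}\lim_{k\to\infty}\big(\Omega_{n_k}^2|\hat{\underline\chi}_{n_k}|^2_{\gamma_{n_k}}dA_{\gamma_{n_k}}du-\Omega_\infty^2|\hat{\underline\chi}_\infty|^2_{\gamma_\infty}dA_{\gamma_\infty}du\big)\ \text{ on }(0,u_* )\times\{\underline u\}\times\mathbb S^2$$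 exist for all $u\in[0,u_*]$, $\underline u\in[0,\underline u_*]$, the limit $(\mathcal M,g_\infty,\{d\nu_u\},\{d\underline\nu_{\underline u}\})$ being a weak solution of the Einstein--null dust system. Then $g_\infty$ is a weak solution to the Einstein vacuum equations if and only if the initial data sets for $g_{n_k}$ converge to a limiting initial data set for the Einstein vacuum equations, i.e. if and only if $d\nu_0=0$ and $d\underline\nu_0=0$.
   Context: **Geometry.** $\mathcal M=[0,u_*]\times[0,\underline u_*]\times\mathbb S^2$ with coordinates $(u,\underline u,\vartheta)$; $S_{u,\underline u}$ are the spheres of constant $(u,\underline u)$. Capital Latin indices in $\{1,2\}$ refer to local coordinates $\theta^A$ on $\mathbb S^2$. $S$-tangent tensors are tensors tangent to the spheres. A metric in double null coordinates is $g=-2\Omega^2(du\otimes d\underline u+d\underline u\otimes du)+\gamma_{AB}(d\theta^A-b^Adu)\otimes(d\theta^B-b^Bdu)$ with $\Omega>0$, $b$ an $S$-tangent vector field, $\gamma$ an $S$-tangent symmetric $2$-tensor, Riemannian on each sphere, all in $C^0\cap W^{1,2}_{loc}$. $\mathcal L$ is the Lie derivative projected to the spheres; $e_3=\Omega^{-1}(\partial_u+b^A\partial_{\theta^A})$, $e_4=\Omega^{-1}\partial_{\underline u}$; $\nabla,K,dA_\gamma$ are the Levi-Civita connection, Gauss curvature and area measure of $\gamma$. The Ricci coefficients $\chi,\underline\chi,\eta,\underline\eta,\omega,\underline\omega$ are determined by $\mathcal L_{\partial_{\underline u}}\gamma=2\Omega\chi$, $\mathcal L_{\partial_u+b}\gamma=2\Omega\underline\chi$,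 $\mathcal L_{\partial_{\underline u}}b=-2\Omega^2(\eta^\sharp-\underline\eta^\sharp)$, $\eta+\underline\eta=2\nabla\log\Omega$, $\omega=-\frac12e_4\log\Omega$, $\underline\omega=-\frac12e_3\log\Omega$; $\mathrm{tr}\chi,\hat\chi$, $\mathrm{tr}\underline\chi,\hat{\underline\chi}$ are the $\gamma$-traces and traceless parts of $\chi,\underline\chi$. For covariant $S$-tangent $\phi$: $(\nabla_3\phi)_{A_1\dots A_r}=\Omega^{-1}(\partial_u+b^C\partial_{\theta^C})\phi_{A_1\dots A_r}-\sum_i(\underline\chi^B{}_{A_i}-\Omega^{-1}\partial_{\theta^{A_i}}b^B)\phi_{A_1\dots B\dots A_r}$, $(\nabla_4\phi)_{A_1\dots A_r}=\Omega^{-1}\partial_{\underline u}\phi_{A_1\dots A_r}-\sum_i\chi^B{}_{A_i}\phi_{A_1\dots B\dots A_r}$. **Null structure equations.** With $(\nabla\hat\otimes\phi)_{AB}=\nabla_A\phi_B+\nabla_B\phi_A-\gamma_{AB}\mathrm{div}\phi$, $(\phi\hat\otimes\psi)_{AB}=\phi_A\psi_B+\phi_B\psi_A-\gamma_{AB}\phi\cdot\psi$, $\cdot$ denoting $\gamma$-contraction: $\nabla_4\mathrm{tr}\chi+\frac12(\mathrm{tr}\chi)^2=-|\hat\chi|^2-2\omega\mathrm{tr}\chi$; $\nabla_3\mathrm{tr}\underline\chi+\frac12(\mathrm{tr}\underline\chi)^2=-|\hat{\underline\chi}|^2-2\underline\omega\mathrm{tr}\underline\chi$; $\nabla_4\eta+\frac34\mathrm{tr}\chi(\eta-\underline\eta)=\mathrm{div}\hat\chi-\frac12\nabla\mathrm{tr}\chi-\frac12(\eta-\underline\eta)\cdot\hat\chi$;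 $\nabla_3\underline\eta+\frac34\mathrm{tr}\underline\chi(\underline\eta-\eta)=\mathrm{div}\hat{\underline\chi}-\frac12\nabla\mathrm{tr}\underline\chi-\frac12(\underline\eta-\eta)\cdot\hat{\underline\chi}$; $\nabla_4\mathrm{tr}\underline\chi+\mathrm{tr}\chi\mathrm{tr}\underline\chi=2\omega\mathrm{tr}\underline\chi-2K+2\mathrm{div}\underline\eta+2|\underline\eta|^2$; $\nabla_3\mathrm{tr}\chi+\mathrm{tr}\underline\chi\mathrm{tr}\chi=2\underline\omega\mathrm{tr}\chi-2K+2\mathrm{div}\eta+2|\eta|^2$; $\nabla_4\hat{\underline\chi}+\frac12\mathrm{tr}\chi\hat{\underline\chi}=\nabla\hat\otimes\underline\eta+2\omega\hat{\underline\chi}-\frac12\mathrm{tr}\underline\chi\hat\chi+\underline\eta\hat\otimes\underline\eta$; $\nabla_3\hat\chi+\frac12\mathrm{tr}\underline\chi\hat\chi=\nabla\hat\otimes\eta+2\underline\omega\hat\chi-\frac12\mathrm{tr}\chi\hat{\underline\chi}+\eta\hat\otimes\eta$; $\nabla_4\underline\omega-2\omega\underline\omega+\eta\cdot\underline\eta-\frac12|\eta|^2=-\frac12(K-\frac12\hat\chi\cdot\hat{\underline\chi}+\frac14\mathrm{tr}\chi\mathrm{tr}\underline\chi)$; $\nabla_3\omega-2\omega\underline\omega+\eta\cdot\underline\eta-\frac12|\underline\eta|^2=-\frac12(K-\frac12\hat\chi\cdot\hat{\underline\chi}+\frac14\mathrm{tr}\chi\mathrm{tr}\underline\chi)$. **Full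 characteristic initial data.** Smooth metric components $(\gamma,\Omega,b)$ and Ricci coefficients on $H_0\cup\underline H_0$, $\gamma$ positive definite, $\Omega>0$, related by the identities defining the Ricci coefficients and satisfying the null structure equations ($\nabla_3$ equations on $\underline H_0$, $\nabla_4$ equations on $H_0$). **(UB).** $\mathring\gamma$ is a fixed smooth metric on $\mathbb S^2$ extended trivially ($\mathcal L_{\partial_{\underline u}}\mathring\gamma=0$ on $H_0$, $\mathcal L_{\partial_u}\mathring\gamma=0$ on $\underline H_0$). The bounds for each $n$: $\|(\gamma,\log\frac{\det\gamma}{\det\mathring\gamma})\|_{L^\infty_uW^{3,2}(S_{u,0},\mathring\gamma)}+\|(\gamma,\log\frac{\det\gamma}{\det\mathring\gamma})\|_{L^\infty_{\underline u}W^{3,2}(S_{0,\underline u},\mathring\gamma)}\le D_0$; $\|(\eta,\underline\eta,\mathrm{tr}\chi,\mathrm{tr}\underline\chi)\|_{L^\infty_uW^{3,2}(S_{u,0},\gamma)}+\|K\|_{L^\infty_uW^{2,2}(S_{u,0},\gamma)}\le D_0$; $\|(\eta,\underline\eta,\mathrm{tr}\chi,\mathrm{tr}\underline\chi)\|_{L^\infty_{\underline u}W^{3,2}(S_{0,\underline u},\gamma)}+\|K\|_{L^\infty_{\underline u}W^{2,2}(S_{0,\underline u},\gamma)}\le D_0$; $\|(\hat{\underline\chi},\underline\omega)\|_{L^2_uW^{3,2}(S_{u,0},\gamma)}+\|(\hat\chi,\omega)\|_{L^2_{\underline u}W^{3,2}(S_{0,\underline u},\gamma)}\le D_0$, where $W^{m,p}(S,\gamma)$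 is the Sobolev norm defined with $\nabla$ and $dA_\gamma$. **Weak solutions.** A $C^0\cap W^{1,2}_{loc}$ Lorentzian metric $g$ is a weak solution to the Einstein vacuum equations if $\int_{\mathcal M}((D_\mu X^\mu)(D_\nu Y^\nu)-D_\mu X^\nu D_\nu Y^\mu)\,\mathrm{dVol}_g=0$ for all smooth compactly supported vector fields $X,Y$, $D$ being the Levi-Civita connection of $g$. With $d\nu=\Omega^2d\nu_udu$, $d\underline\nu=\Omega^2d\underline\nu_{\underline u}d\underline u$ on $\mathcal M$, $(g,\{d\nu_u\},\{d\underline\nu_{\underline u}\})$ is a weak solution of the Einstein--null dust system if for all such $X,Y$ the same integral equals $\int(Xu)(Yu)d\nu+\int(X\underline u)(Y\underline u)d\underline\nu$ and $\int g^{-1}(du,d\varphi)d\nu=0=\int g^{-1}(d\underline u,d\varphi)d\underline\nu$ for every smooth compactly supported $\varphi$. More precisely the families satisfy: for $u_1<u_2$ and $\varphi\in C^1_c([0,u_*]\times(0,\underline u_* )\times\mathbb S^2)$, $\int\varphi\,d\nu_{u_2}=\int\varphi\,d\nu_{u_1}+\int_{u_1}^{u_2}\int(\partial_u\varphi+\nabla_{b_\infty}\varphi)d\nu_udu$; for $\underline u_1<\underline u_2$ and $\varphi\in C^1_c((0,u_* )\times[0,\underline u_*]\times\mathbb S^2)$, $\int\varphi\,d\underline\nu_{\underline u_2}=\int\varphi\,d\underline\nu_{\underline u_1}+\int_{\underline u_1}^{\underline u_2}\int\partial_{\underline u}\varphi\,d\underline\nu_{\underline u}d\underline u$. That $g_n$,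 $g_{n_k}$, $g_\infty$ and the measures with the listed properties exist is part of the setting. *)

(* Defs.v *)
From HB Require Import structures.
From mathcomp Require Import all_boot all_order all_algebra.
From mathcomp Require Import all_classical all_reals all_analysis.
From mathcomp Require Import measurable_realfun.

Set Implicit Arguments.
Unset Strict Implicit.
Unset Printing Implicit Defensive.

Import Order.TTheory GRing.Theory Num.Theory.
Import numFieldNormedType.Exports.

Local Open Scope classical_set_scope.
Local Open Scope ring_scope.

(* The sphere is covered by the two stereographic charts, indexed by [bool] and
   each with domain the whole plane:
     true  : x |-> (2 x, |x|^2 - 1) / (1 + |x|^2)   (misses the north pole),
     false : x |-> (2 x, 1 - |x|^2) / (1 + |x|^2)   (misses the south pole).
   The transition map is the inversion x |-> x / |x|^2 in both directions.  An
   object on the sphere is a family, indexed by the charts, of component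
   functions related by the usual transformation law; the closed unit discs of
   the two charts are the closed hemispheres.
   Points of a null hypersurface are (s, x1, x2) and points of the spacetime are
   (u, ubar, x1, x2), all products being nested to the left. *)

Notation plane R := (R * R)%type.
Notation hpt R := (R * R * R)%type.
Notation pt R := (R * R * R * R)%type.

(* Components of a covariant tensor: [T [:: A1; ..; Ar]] is T_{A1..Ar}.  Only the
   lists whose length is the rank of the tensor are meaningful. *)
Notation cot R := (seq 'I_2 -> R).

(* The measurable space R x R^3, in which (0, a) x S^2 is embedded. *)
Notation cylinder R :=
  (measurableTypeR R *
   (measurableTypeR R * measurableTypeR R * measurableTypeR R))%type.

Notation leb1 R := (@lebesgue_measure R).
Notation leb2 R := (leb1 R \x leb1 R)%E.
Notation leb3 R := (leb2 R \x leb1 R)%E.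
Notation leb4 R := (leb3 R \x leb1 R)%E.

Section Smoothness.
Context {R : realType}.

Fixpoint Ck (V : normedModType R) (k : nat) (f : V -> R) : Prop :=
  continuous f /\
  if k is k'.+1 then
    forall v, (forall x, derivable f x v) /\ Ck k' (fun x => 'D_v f x)
  else True.

(* A function on a closed domain with boundary is smooth (resp. C^k) when it is
   the restriction of a smooth (resp. C^k) function defined everywhere.  Below,
   fields are total functions carrying such an extension, and everything else
   is only ever required on the closed domain. *)
Definition smooth (V : normedModType R) (f : V -> R) := forall k, Ck k f.

End Smoothness.

Section Plane.
Context {R : realType}.
Implicit Types (x : plane R) (A B : 'I_2).

Definition coord x A : R := if A == ord0 then x.1 else x.2.
Definition normsq x : R := x.1 ^+ 2 + x.2 ^+ 2.
Definition disc (r : R) : set (plane R) := [set x | normsq x <= r ^+ 2].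
Definition inversion x : plane R := (x.1 / normsq x, x.2 / normsq x).

Definition unitv A : plane R := ((A == ord0)%:R, (A != ord0)%:R).
Definition pd A (f : plane R -> R) x : R := 'D_(unitv A) f x.

(* pds [:: A1; ..; Ak] f = d_A1 (.. (d_Ak f)) *)
Definition pds (s : seq 'I_2) (f : plane R -> R) : plane R -> R := foldr pd f s.

(* d_B of the component A of the inversion *)
Definition jac x A B : R :=
  ((A == B)%:R * normsq x - 2 * coord x A * coord x B) / normsq x ^+ 2.

Definition S_scalar (f : bool -> plane R -> R) :=
  forall c x, 0 < normsq x -> f c x = f (~~ c) (inversion x).

Definition S_vector (b : bool -> plane R -> 'I_2 -> R) :=
  forall c x A, 0 < normsq x ->
    b (~~ c) (inversion x) A = \sum_B jac x A B * b c x B.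

Definition S_cotensor (r : nat) (T : bool -> plane R -> cot R) :=
  forall c x (l : r.-tuple 'I_2), 0 < normsq x ->
    T c x l = \sum_(l' : r.-tuple 'I_2)
      (\prod_(i < r) jac x (tnth l' i) (tnth l i)) *
      T (~~ c) (inversion x) l'.

Definition S_sym2 (T : bool -> plane R -> cot R) :=
  S_cotensor 2 T /\ forall c x A B, T c x [:: A; B] = T c x [:: B; A].

Definition S_metric (g : bool -> plane R -> cot R) :=
  S_sym2 g /\
  forall c x (v : 'I_2 -> R), (exists A, v A != 0) ->
    0 < \sum_A \sum_B g c x [:: A; B] * v A * v B.

End Plane.

(* The function on R^3 which, on the unit sphere, is represented in the charts
   by F.  Each point of the sphere is read in the chart whose closed unit disc
   contains it. *)
Definition from_charts {R : realType} (F : bool -> plane R -> R) (p : R * R * R) : R :=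
  if p.2 <= 0 then F true (p.1.1 / (1 - p.2), p.1.2 / (1 - p.2))
  else F false (p.1.1 / (1 + p.2), p.1.2 / (1 + p.2)).

Section SphereGeometry.
Context {R : realType}.
Variable g : plane R -> cot R.
Implicit Types (x : plane R) (T : plane R -> cot R) (l : seq 'I_2).

Definition gmx x : 'M[R]_2 := \matrix_(A, B) g x [:: A; B].
Definition ginv x : 'M[R]_2 := invmx (gmx x).
Definition area x : R := Num.sqrt (\det (gmx x)).

(* Gamma^C_AB *)
Definition christ C A B x : R :=
  2^-1 * \sum_D ginv x C D *
    (pd A (fun y => g y [:: D; B]) x + pd B (fun y => g y [:: D; A]) x
     - pd D (fun y => g y [:: A; B]) x).

(* (nabla T)_{A A1 .. Ar} = nabla_A T_{A1 .. Ar} *)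
Definition nabla T x (l : seq 'I_2) : R :=
  if l is A :: l' then
    pd A (fun y => T y l') x
    - \sum_(i < size l') \sum_B
        christ B A (nth ord0 l' i) x * T x (set_nth ord0 l' i B)
  else 0.

(* R_CB = R^A_CAB *)
Definition ricci2 C B x : R :=
  \sum_A (pd A (christ A B C) x - pd B (christ A A C) x
    + \sum_D (christ A A D x * christ D B C x
              - christ A B D x * christ D A C x)).

Definition gauss x : R := 2^-1 * \sum_A \sum_B ginv x A B * ricci2 A B x.

Definition sc (f : plane R -> R) : plane R -> cot R := fun x _ => f x.

Definition ip (r : nat) T T' x : R :=
  \sum_(l : r.-tuple 'I_2) \sum_(l' : r.-tuple 'I_2)
    (\prod_(i < r) ginv x (tnth l i) (tnth l' i)) * T x l * T' x l'.

Definition tr T x : R := \sum_A \sum_B ginv x A B * T x [:: A; B].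

Definition hat T : plane R -> cot R :=
  fun x l => T x l - 2^-1 * tr T x * g x l.

Definition dvg T : plane R -> cot R :=
  fun x l => \sum_A \sum_C ginv x A C * nabla T x (A :: C :: l).

(* nabla_A phi_B + nabla_B phi_A - g_AB div phi *)
Definition nablahat T : plane R -> cot R :=
  fun x l => nabla T x l + nabla T x (rev l) - g x l * dvg T x [::].

Definition otimeshat T T' : plane R -> cot R :=
  fun x l => T x [:: nth ord0 l 0] * T' x [:: nth ord0 l 1]
    + T x [:: nth ord0 l 1] * T' x [:: nth ord0 l 0] - g x l * ip 1 T T' x.

(* (phi . k)_A = g^{BC} phi_B k_CA *)
Definition dot12 T k : plane R -> cot R :=
  fun x l => \sum_B \sum_C ginv x B C * T x [:: B] * k x (C :: l).

(* k^B_A *)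
Definition mixed (k : plane R -> cot R) x B A : R :=
  \sum_C ginv x B C * k x [:: C; A].

End SphereGeometry.

Section NullHypersurface.
Context {R : realType}.
Implicit Types (phi k g : R -> plane R -> cot R) (b : R -> plane R -> 'I_2 -> R).

Definition lie b phi (s : R) (x : plane R) (l : seq 'I_2) : R :=
  derive1 (fun t => phi t x l) s
  + \sum_C b s x C * pd C (fun y => phi s y l) x
  + \sum_(i < size l) \sum_C
      pd (nth ord0 l i) (fun y => b s y C) x * phi s x (set_nth ord0 l i C).

(* The covariant derivative in the null direction Om^-1 (d_s + b), where k is
   the second fundamental form in that direction.  It is nabla_3 for
   (s, b, k) = (u, b, chibar) and nabla_4 for (s, b, k) = (ubar, 0, chi). *)
Definition nablaN (Om : R -> plane R -> R) b k g phi s x (l : seq 'I_2) : R :=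
  (Om s x)^-1 * lie b phi s x l
  - \sum_(i < size l) \sum_B
      mixed (g s) (k s) x B (nth ord0 l i) * phi s x (set_nth ord0 l i B).

Definition scH (f : R -> plane R -> R) : R -> plane R -> cot R :=
  fun s => sc (f s).

(* The null structure equations along one family of null generators.  The
   nabla_4 equations are obtained for (k, kb, e, eb, w, wb) =
   (chi, chibar, eta, etabar, omega, omegabar), and the nabla_3 equations by
   exchanging barred and unbarred quantities. *)
Definition null_structure (a : R) (Om : R -> plane R -> R) b g k kb
    (e eb : R -> plane R -> cot R) (w wb : R -> plane R -> R) : Prop :=
  let trk := fun s x => tr (g s) (k s) x in
  let trkb := fun s x => tr (g s) (kb s) x in
  let kh := fun s => hat (g s) (k s) in
  let kbh := fun s => hat (g s) (kb s) in
  let de := fun s x l => e s x l - eb s x l in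
  let dN := nablaN Om b k g in
  forall s x, 0 <= s <= a ->
  [/\ dN (scH trk) s x [::] + 2^-1 * trk s x ^+ 2
      = - ip (g s) 2 (kh s) (kh s) x - 2 * w s x * trk s x,
      forall A, dN e s x [:: A] + 3 / 4 * trk s x * de s x [:: A]
      = dvg (g s) (kh s) x [:: A] - 2^-1 * pd A (trk s) x
        - 2^-1 * dot12 (g s) (de s) (kh s) x [:: A],
      dN (scH trkb) s x [::] + trk s x * trkb s x
      = 2 * w s x * trkb s x - 2 * gauss (g s) x
        + 2 * dvg (g s) (eb s) x [::] + 2 * ip (g s) 1 (eb s) (eb s) x,
      forall A B, dN kbh s x [:: A; B] + 2^-1 * trk s x * kbh s x [:: A; B]
      = nablahat (g s) (eb s) x [:: A; B] + 2 * w s x * kbh s x [:: A; B]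
        - 2^-1 * trkb s x * kh s x [:: A; B]
        + otimeshat (g s) (eb s) (eb s) x [:: A; B] &
      dN (scH wb) s x [::] - 2 * w s x * wb s x + ip (g s) 1 (e s) (eb s) x
        - 2^-1 * ip (g s) 1 (e s) (e s) x
      = - 2^-1 * (gauss (g s) x - 2^-1 * ip (g s) 2 (kh s) (kbh s) x
                  + 4^-1 * trk s x * trkb s x)].

End NullHypersurface.

Record hdata (R : realType) := HData {
  hgam : bool -> R -> plane R -> cot R;
  hlap : bool -> R -> plane R -> R;
  hshf : bool -> R -> plane R -> 'I_2 -> R;
  hchi : bool -> R -> plane R -> cot R;
  hchib : bool -> R -> plane R -> cot R;
  heta : bool -> R -> plane R -> cot R;
  hetab : bool -> R -> plane R -> cot R;
  hw : bool -> R -> plane R -> R;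
  hwb : bool -> R -> plane R -> R }.

(* Characteristic data: on H_0 (parameter ubar) and on Hbar_0 (parameter u). *)
Record chardata (R : realType) := CharData { onH : hdata R; onHb : hdata R }.

Section CharacteristicData.
Context {R : realType}.

Definition smoothH (f : R -> plane R -> R) :=
  smooth (fun p : hpt R => f p.1.1 (p.1.2, p.2)).

Definition smoothH_cot (r : nat) (T : bool -> R -> plane R -> cot R) :=
  forall c (l : r.-tuple 'I_2), smoothH (fun s x => T c s x l).

Definition hdata_regular (a : R) (D : hdata R) :=
  [/\ smoothH_cot 2 (hgam D), (forall c, smoothH (hlap D c)) &
      (forall c A, smoothH (fun s x => hshf D c s x A))] /\
  [/\ smoothH_cot 2 (hchi D), smoothH_cot 2 (hchib D),
      smoothH_cot 1 (heta D) & smoothH_cot 1 (hetab D)] /\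
  (forall c, smoothH (hw D c)) /\ (forall c, smoothH (hwb D c)) /\
  (forall s, 0 <= s <= a ->
    [/\ S_metric (fun c => hgam D c s), S_scalar (fun c => hlap D c s),
        (forall c x, 0 < hlap D c s x) & S_vector (fun c => hshf D c s)] /\
    [/\ S_sym2 (fun c => hchi D c s), S_sym2 (fun c => hchib D c s),
        S_cotensor 1 (fun c => heta D c s) &
        S_cotensor 1 (fun c => hetab D c s)] /\
    S_scalar (fun c => hw D c s) /\ S_scalar (fun c => hwb D c s)).

(* The defining identities of the Ricci coefficients which only involve
   derivatives tangent to the hypersurface. *)

Definition identity_grad (a : R) (D : hdata R) :=
  forall c s x A, 0 <= s <= a ->
    heta D c s x [:: A] + hetab D c s x [:: A]
    = 2 * pd A (fun y => ln (hlap D c s y)) x.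

Definition identities_H (a : R) (D : hdata R) :=
  identity_grad a D /\
  forall c s x, 0 <= s <= a ->
  [/\ forall A B, derive1 (fun t => hgam D c t x [:: A; B]) s
        = 2 * hlap D c s x * hchi D c s x [:: A; B],
      forall A, derive1 (fun t => hshf D c t x A) s
        = - 2 * hlap D c s x ^+ 2 * \sum_B ginv (hgam D c s) x A B *
            (heta D c s x [:: B] - hetab D c s x [:: B]) &
      hw D c s x
        = - 2^-1 * (hlap D c s x)^-1 * derive1 (fun t => ln (hlap D c t x)) s].

Definition identities_Hb (a : R) (D : hdata R) :=
  identity_grad a D /\
  forall c s x, 0 <= s <= a ->
  (forall A B, lie (hshf D c) (hgam D c) s x [:: A; B]
     = 2 * hlap D c s x * hchib D c s x [:: A; B]) /\
  hwb D c s x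
     = - 2^-1 * (hlap D c s x)^-1 *
       lie (hshf D c) (scH (fun t y => ln (hlap D c t y))) s x [::].

Definition structure_H (a : R) (D : hdata R) :=
  forall c, null_structure a (hlap D c) (fun _ _ _ => 0) (hgam D c)
    (hchi D c) (hchib D c) (heta D c) (hetab D c) (hw D c) (hwb D c).

Definition structure_Hb (a : R) (D : hdata R) :=
  forall c, null_structure a (hlap D c) (hshf D c) (hgam D c)
    (hchib D c) (hchi D c) (hetab D c) (heta D c) (hwb D c) (hw D c).

(* The two parts of the data coincide on S_{0,0}. *)
Definition corner (D D' : hdata R) :=
  forall c x,
  [/\ forall A B, hgam D c 0 x [:: A; B] = hgam D' c 0 x [:: A; B],
      hlap D c 0 x = hlap D' c 0 x &
      forall A, hshf D c 0 x A = hshf D' c 0 x A] /\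
  [/\ forall A B, hchi D c 0 x [:: A; B] = hchi D' c 0 x [:: A; B],
      forall A B, hchib D c 0 x [:: A; B] = hchib D' c 0 x [:: A; B],
      forall A, heta D c 0 x [:: A] = heta D' c 0 x [:: A] &
      forall A, hetab D c 0 x [:: A] = hetab D' c 0 x [:: A]] /\
  hw D c 0 x = hw D' c 0 x /\ hwb D c 0 x = hwb D' c 0 x.

(* H_0 = {0} x [0, Ib] x S^2 and Hbar_0 = [0, I] x {0} x S^2 *)
Definition full_characteristic_data (I Ib : R) (d : chardata R) :=
  [/\ hdata_regular Ib (onH d), identities_H Ib (onH d) &
      structure_H Ib (onH d)] /\
  [/\ hdata_regular I (onHb d), identities_Hb I (onHb d) &
      structure_Hb I (onHb d)] /\
  corner (onH d) (onHb d).

End CharacteristicData.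

Section UniformBounds.
Context {R : realType}.
Local Open Scope ereal_scope.

Definition sphere_int (g : bool -> plane R -> cot R) (f : bool -> plane R -> R)
    : \bar R :=
  \sum_(c : bool) \int[leb2 R]_(x in disc 1) (f c x * area (g c) x)%:E.

(* The norm W^{m,2}(S, g) of a covariant tensor of rank r. *)
Definition sobolev (g : bool -> plane R -> cot R) (m r : nat)
    (T : bool -> plane R -> cot R) : \bar R :=
  \sum_(i < m.+1)
    (sphere_int g (fun c x =>
       let DT := iter i (nabla (g c)) (T c) in ip (g c) (i + r) DT DT x)) `^ 2^-1.

Definition Linf (a : R) (N : R -> \bar R) : \bar R :=
  ereal_sup [set N s | s in `[0%R, a]].

Definition L2norm (a : R) (N : R -> \bar R) : \bar R :=
  (\int[leb1 R]_(s in `[0%R, a]) (N s * N s)) `^ 2^-1.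

Definition norm_metric (gring : bool -> plane R -> cot R) (D : hdata R) (s : R) :=
  sobolev gring 3 2 (fun c => hgam D c s) +
  sobolev gring 3 0 (fun c => sc (fun x =>
    ln (\det (gmx (hgam D c s) x) / \det (gmx (gring c) x))%R)).

Definition norm_ricci (D : hdata R) (s : R) :=
  let g := fun c => hgam D c s in
  sobolev g 3 1 (fun c => heta D c s) + sobolev g 3 1 (fun c => hetab D c s) +
  sobolev g 3 0 (fun c => sc (tr (g c) (hchi D c s))) +
  sobolev g 3 0 (fun c => sc (tr (g c) (hchib D c s))).

Definition norm_gauss (D : hdata R) (s : R) :=
  let g := fun c => hgam D c s in
  sobolev g 2 0 (fun c => sc (gauss (g c))).

Definition norm_shear (k : bool -> R -> plane R -> cot R)
    (w : bool -> R -> plane R -> R) (D : hdata R) (s : R) :=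
  let g := fun c => hgam D c s in
  sobolev g 3 2 (fun c => hat (g c) (k c s)) +
  sobolev g 3 0 (fun c => sc (w c s)).

Definition uniform_bounds (I Ib D0 : R) (gring : bool -> plane R -> cot R)
    (d : chardata R) :=
  [/\ Linf I (norm_metric gring (onHb d)) + Linf Ib (norm_metric gring (onH d))
        <= D0%:E,
      Linf I (norm_ricci (onHb d)) + Linf I (norm_gauss (onHb d)) <= D0%:E,
      Linf Ib (norm_ricci (onH d)) + Linf Ib (norm_gauss (onH d)) <= D0%:E &
      L2norm I (norm_shear (hchib (onHb d)) (hwb (onHb d)) (onHb d)) +
      L2norm Ib (norm_shear (hchi (onH d)) (hw (onH d)) (onH d)) <= D0%:E].

End UniformBounds.

Section InitialSphere.
Context {R : realType}.

Definition smooth_S_metric (g : bool -> plane R -> cot R) :=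
  S_metric g /\ forall c A B, smooth (fun x => g c x [:: A; B]).

Definition C3_converges (gs : nat -> bool -> plane R -> cot R)
    (g : bool -> plane R -> cot R) :=
  [/\ S_metric g, forall c A B, Ck 3 (fun x => g c x [:: A; B]) &
      forall c A B (s : seq 'I_2), (size s <= 3)%N ->
        {uniform disc 1, (fun n => pds s (fun x => gs n c x [:: A; B])) @ \oo
           --> pds s (fun x => g c x [:: A; B])}].

End InitialSphere.

(* The components (gamma, Omega, b) of a metric in double null coordinates. *)
Record dnmetric (R : realType) := DNMetric {
  gam : bool -> pt R -> cot R;
  lap : bool -> pt R -> R;
  shf : bool -> pt R -> 'I_2 -> R }.

(* First derivatives of (gamma, Omega, b): the index is that of the coordinate
   (u, ubar, x1, x2).  They are classical for the smooth metrics and weak for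
   the limit. *)
Record dnjet (R : realType) := DNJet {
  dgam : 'I_4 -> bool -> pt R -> cot R;
  dlap : 'I_4 -> bool -> pt R -> R;
  dshf : 'I_4 -> bool -> pt R -> 'I_2 -> R }.

Section Spacetime.
Context {R : realType}.

Definition mk (u ub : R) (x : plane R) : pt R := (u, ub, x.1, x.2).
Definition uof (p : pt R) : R := p.1.1.1.
Definition ubof (p : pt R) : R := p.1.1.2.
Definition xof (p : pt R) : plane R := (p.1.2, p.2).

Definition iu : 'I_4 := @Ordinal 4 0 isT.
Definition iub : 'I_4 := @Ordinal 4 1 isT.
Definition ith (A : 'I_2) : 'I_4 := rshift 2 A.

Definition cbasis (m : 'I_4) : pt R :=
  ((m == 0 :> nat)%:R, (m == 1 :> nat)%:R, (m == 2 :> nat)%:R,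
   (m == 3 :> nat)%:R).
Definition pd4 (m : 'I_4) (f : pt R -> R) (p : pt R) : R := 'D_(cbasis m) f p.

(* [0, us] x [0, ubs] x R^2, and its part over the disc of radius r *)
Definition chartM (us ubs : R) : set (pt R) :=
  [set p | 0 <= uof p <= us /\ 0 <= ubof p <= ubs].
Definition chartMr (us ubs r : R) : set (pt R) :=
  [set p | chartM us ubs p /\ disc r (xof p)].

Definition intM (us ubs : R) (F : bool -> pt R -> R) : R :=
  \sum_(c : bool) \int[leb4 R]_(p in chartMr us ubs 1) F c p.

Definition slice (T : bool -> pt R -> cot R) (u ub : R) :
    bool -> plane R -> cot R := fun c x => T c (mk u ub x).

Definition dn_metric (us ubs : R) (m : dnmetric R) :=
  forall u ub, 0 <= u <= us -> 0 <= ub <= ubs ->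
  [/\ S_metric (slice (gam m) u ub), S_scalar (fun c x => lap m c (mk u ub x)),
      (forall c x, 0 < lap m c (mk u ub x)) &
      S_vector (fun c x => shf m c (mk u ub x))].

Definition dn_smooth (m : dnmetric R) :=
  [/\ forall c A B, smooth (fun p => gam m c p [:: A; B]),
      forall c, smooth (lap m c) &
      forall c A, smooth (fun p => shf m c p A)].

Definition classical_jet (m : dnmetric R) : dnjet R :=
  DNJet (fun i c p l => pd4 i (fun q => gam m c q l) p)
        (fun i c p => pd4 i (lap m c) p)
        (fun i c p A => pd4 i (fun q => shf m c q A) p).

(* Solving the defining identities for the Ricci coefficients. *)
Section RicciCoefficients.
Variables (m : dnmetric R) (j : dnjet R).
Implicit Types (c : bool) (p : pt R) (l : seq 'I_2).

Definition chi c p l : R := (2 * lap m c p)^-1 * dgam j iub c p l.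

Definition chib c p l : R :=
  (2 * lap m c p)^-1 *
  (dgam j iu c p l + \sum_C shf m c p C * dgam j (ith C) c p l
   + \sum_(i < size l) \sum_C
       dshf j (ith (nth ord0 l i)) c p C * gam m c p (set_nth ord0 l i C)).

(* d_ubar b lowered with gamma *)
Definition dub_shift c p (A : 'I_2) : R :=
  \sum_B gam m c p [:: A; B] * dshf j iub c p B.

Definition eta c p (A : 'I_2) : R :=
  dlap j (ith A) c p / lap m c p
  - 4^-1 * (lap m c p) ^- 2 * dub_shift c p A.

Definition etab c p (A : 'I_2) : R :=
  dlap j (ith A) c p / lap m c p
  + 4^-1 * (lap m c p) ^- 2 * dub_shift c p A.

Definition om c p : R := - 2^-1 * dlap j iub c p / (lap m c p) ^+ 2.

Definition omb c p : R :=
  - 2^-1 * (dlap j iu c p + \sum_C shf m c p C * dlap j (ith C) c p)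
    / (lap m c p) ^+ 2.

(* Omega^2 |khat|^2 times the area density, for a 2-tensor k *)
Definition shear_density (k : bool -> pt R -> cot R) c p : R :=
  let g := fun x => gam m c (mk (uof p) (ubof p) x) in
  let kh := hat g (fun x => k c (mk (uof p) (ubof p) x)) in
  lap m c p ^+ 2 * ip g 2 kh kh (xof p) * area g (xof p).

End RicciCoefficients.

Section Einstein.
Variables (m : dnmetric R) (j : dnjet R).
Implicit Types (c : bool) (p : pt R) (a b l : 'I_4).

Definition dlt (a b : 'I_4) : R := (a == b)%:R.

(* Component a of dx^A - b^A du. *)
Definition theta c p (A : 'I_2) a : R := dlt a (ith A) - shf m c p A * dlt a iu.
Definition dtheta l c p (A : 'I_2) a : R := - dshf j l c p A * dlt a iu.

Definition dudub a b : R := dlt a iu * dlt b iub + dlt a iub * dlt b iu.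

Definition g4 c p : 'M[R]_4 := \matrix_(a, b)
  (- 2 * lap m c p ^+ 2 * dudub a b
   + \sum_A \sum_B gam m c p [:: A; B] * theta c p A a * theta c p B b).

(* d_l g_ab *)
Definition dg4 l c p a b : R :=
  - 4 * lap m c p * dlap j l c p * dudub a b
  + \sum_A \sum_B
     (dgam j l c p [:: A; B] * theta c p A a * theta c p B b
      + gam m c p [:: A; B] * dtheta l c p A a * theta c p B b
      + gam m c p [:: A; B] * theta c p A a * dtheta l c p B b).

Definition g4inv c p : 'M[R]_4 := invmx (g4 c p).
Definition vol4 c p : R := Num.sqrt `|\det (g4 c p)|.

(* Gamma^l_ab *)
Definition christ4 l a b c p : R :=
  2^-1 * \sum_d g4inv c p l d * (dg4 a c p d b + dg4 b c p d a - dg4 d c p a b).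

(* D_a X^b *)
Definition covD (X : bool -> pt R -> 'I_4 -> R) c p a b : R :=
  pd4 a (fun q => X c q b) p + \sum_l christ4 b a l c p * X c p l.

Definition ricci_form (us ubs : R) (X Y : bool -> pt R -> 'I_4 -> R) : R :=
  intM us ubs (fun c p =>
    ((\sum_a covD X c p a a) * (\sum_b covD Y c p b b)
     - \sum_a \sum_b covD X c p a b * covD Y c p b a) * vol4 c p).

(* g^{-1}(dx^a, d phi) *)
Definition gradc (phi : bool -> pt R -> R) a c p : R :=
  \sum_b g4inv c p a b * pd4 b (phi c) p.

End Einstein.

Definition ricci4 (m : dnmetric R) (a b : 'I_4) c p : R :=
  let G := christ4 m (classical_jet m) in
  \sum_l (pd4 l (G l a b c) p - pd4 b (G l a l c) p
    + \sum_d (G l l d c p * G d a b c p - G l b d c p * G d a l c p)).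

(* The metric and Ricci coefficients of m agree with the data on the part of
   H_0 and of Hbar_0 contained in M; S s is the sphere with parameter s. *)
Definition induces (m : dnmetric R) (a : R) (S : R -> plane R -> pt R)
    (D : hdata R) :=
  let j := classical_jet m in
  forall c s x, 0 <= s <= a ->
  [/\ forall A B, gam m c (S s x) [:: A; B] = hgam D c s x [:: A; B],
      lap m c (S s x) = hlap D c s x &
      forall A, shf m c (S s x) A = hshf D c s x A] /\
  [/\ forall A B, chi m j c (S s x) [:: A; B] = hchi D c s x [:: A; B],
      forall A B, chib m j c (S s x) [:: A; B] = hchib D c s x [:: A; B],
      forall A, eta m j c (S s x) A = heta D c s x [:: A] &
      forall A, etab m j c (S s x) A = hetab D c s x [:: A]] /\
  om m j c (S s x) = hw D c s x /\ omb m j c (S s x) = hwb D c s x.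

Definition vacuum_solution (us ubs : R) (d : chardata R) (m : dnmetric R) :=
  [/\ dn_smooth m, dn_metric us ubs m,
      (forall c p a b, chartM us ubs p -> ricci4 m a b c p = 0),
      induces m ubs (fun s => mk 0 s) (onH d) &
      induces m us (fun s => mk s 0) (onHb d)].

Definition compact_support (us ubs : R) (f : bool -> pt R -> R) :=
  exists e : R, 0 < e /\
    forall c p, f c p != 0 ->
      e <= uof p <= us - e /\ e <= ubof p <= ubs - e.

Definition S_function (f : bool -> pt R -> R) :=
  forall u ub, S_scalar (fun c x => f c (mk u ub x)).

Definition test_function (us ubs : R) (f : bool -> pt R -> R) :=
  [/\ forall c, smooth (f c), S_function f & compact_support us ubs f].

Definition test_field (us ubs : R) (X : bool -> pt R -> 'I_4 -> R) :=
  [/\ forall c a, smooth (fun p => X c p a),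
      S_function (fun c p => X c p iu), S_function (fun c p => X c p iub),
      (forall u ub, S_vector (fun c x A => X c (mk u ub x) (ith A))) &
      forall a, compact_support us ubs (fun c p => X c p a)].

Definition weak_vacuum (us ubs : R) (m : dnmetric R) (j : dnjet R) :=
  forall X Y, test_field us ubs X -> test_field us ubs Y ->
    ricci_form m j us ubs X Y = 0.

End Spacetime.

Section WeakDerivatives.
Context {R : realType}.

Definition L2on d (T : measurableType d) (mu : set T -> \bar R) (A : set T)
    (f : T -> R) :=
  measurable_fun A f /\ (\int[mu]_(p in A) (f p ^+ 2)%:E < +oo)%E.

(* df is the weak derivative of f in the direction v on
   (0, us) x (0, ubs) x R^2 *)
Definition weak_derivative4 (us ubs : R) (v : pt R) (f df : pt R -> R) :=
  forall phi : pt R -> R, smooth phi ->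
    (exists e r : R, 0 < e /\ forall p, phi p != 0 ->
       [/\ e <= uof p <= us - e, e <= ubof p <= ubs - e & disc r (xof p)]) ->
    \int[leb4 R]_p (f p * 'D_v phi p) = - \int[leb4 R]_p (df p * phi p).

(* the same on (0, a) x R^2 *)
Definition weak_derivative3 (a : R) (v : hpt R) (f df : hpt R -> R) :=
  forall phi : hpt R -> R, smooth phi ->
    (exists e r : R, 0 < e /\ forall p, phi p != 0 ->
       e <= p.1.1 <= a - e /\ disc r (p.1.2, p.2)) ->
    \int[leb3 R]_p (f p * 'D_v phi p) = - \int[leb3 R]_p (df p * phi p).

Definition sobolev12 (us ubs : R) (f : pt R -> R) (df : 'I_4 -> pt R -> R) :=
  {within chartM us ubs, continuous f} /\
  forall i, weak_derivative4 us ubs (cbasis i) f (df i) /\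
    forall r, L2on (leb4 R) (chartMr us ubs r) (df i).

(* A C^0 cap W^{1,2} metric in double null coordinates with weak derivatives j. *)
Definition weak_metric (us ubs : R) (m : dnmetric R) (j : dnjet R) :=
  [/\ dn_metric us ubs m,
      forall c A B, sobolev12 us ubs (fun p => gam m c p [:: A; B])
        (fun i p => dgam j i c p [:: A; B]),
      forall c, sobolev12 us ubs (lap m c) (fun i p => dlap j i c p) &
      forall c A, sobolev12 us ubs (fun p => shf m c p A)
        (fun i p => dshf j i c p A)].

(* Points of {u} x (0, ubs) x R^2 and of (0, us) x {ub} x R^2. *)
Definition outp (u : R) (q : hpt R) : pt R := (u, q.1.1, q.1.2, q.2).
Definition inp (ub : R) (q : hpt R) : pt R := (q.1.1, ub, q.1.2, q.2).

Definition tangent3 (a : R) (v : hpt R) (f df : hpt R -> R) :=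
  weak_derivative3 a v f df /\
  forall r : R,
    L2on (leb3 R) [set q | 0 <= q.1.1 <= a /\ disc r (q.1.2, q.2)] df.

Definition sdir : hpt R := (1, 0, 0).
Definition xdir (A : 'I_2) : hpt R := (0, (A == ord0)%:R, (A != ord0)%:R).

(* chi and chibar, a priori only defined almost everywhere, have well-defined
   square integrable traces on every {u} x (0, ubs) x S^2, respectively every
   (0, us) x {ub} x S^2: the chosen derivatives of gamma and b entering their
   definition are weak derivatives on each of these hypersurfaces. *)
Definition sliced_jet (us ubs : R) (m : dnmetric R) (j : dnjet R) :=
  (forall u c A B, 0 <= u <= us ->
     tangent3 ubs sdir (fun q => gam m c (outp u q) [:: A; B])
       (fun q => dgam j iub c (outp u q) [:: A; B])) /\
  (forall ub c A B, 0 <= ub <= ubs ->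
   [/\ tangent3 us sdir (fun q => gam m c (inp ub q) [:: A; B])
         (fun q => dgam j iu c (inp ub q) [:: A; B]),
       forall C, tangent3 us (xdir C) (fun q => gam m c (inp ub q) [:: A; B])
         (fun q => dgam j (ith C) c (inp ub q) [:: A; B]) &
       forall C, tangent3 us (xdir C) (fun q => shf m c (inp ub q) A)
         (fun q => dshf j (ith C) c (inp ub q) A)]).

End WeakDerivatives.

Section Convergence.
Context {R : realType}.
Variables us ubs : R.

Definition uniform_cvg (fs : nat -> pt R -> R) (f : pt R -> R) :=
  forall r : R, {uniform chartMr us ubs r, fs @ \oo --> f}.

Definition weak_L2_cvg (fs : nat -> pt R -> R) (f : pt R -> R) :=
  forall (r : R) (h : pt R -> R), L2on (leb4 R) (chartMr us ubs r) h ->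
    (fun k => \int[leb4 R]_(p in chartMr us ubs r) (fs k p * h p)) @ \oo
      --> \int[leb4 R]_(p in chartMr us ubs r) (f p * h p).

Variables (gs : nat -> dnmetric R) (m : dnmetric R) (j : dnjet R).
Let js k := classical_jet (gs k).

Definition C0_converges :=
  [/\ forall c A B, uniform_cvg (fun k p => gam (gs k) c p [:: A; B])
        (fun p => gam m c p [:: A; B]),
      forall c, uniform_cvg (fun k => lap (gs k) c) (lap m c) &
      forall c A, uniform_cvg (fun k p => shf (gs k) c p A)
        (fun p => shf m c p A)].

(* With C0_converges, weak convergence in W^{1,2}. *)
Definition derivatives_converge :=
  [/\ forall i c A B, weak_L2_cvg (fun k p => dgam (js k) i c p [:: A; B])
        (fun p => dgam j i c p [:: A; B]),
      forall i c, weak_L2_cvg (fun k => dlap (js k) i c) (dlap j i c) &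
      forall i c A, weak_L2_cvg (fun k p => dshf (js k) i c p A)
        (fun p => dshf j i c p A)].

Definition ricci_coefficients_converge :=
  [/\ forall c A B, weak_L2_cvg (fun k p => chi (gs k) (js k) c p [:: A; B])
        (fun p => chi m j c p [:: A; B]),
      forall c A B, weak_L2_cvg (fun k p => chib (gs k) (js k) c p [:: A; B])
        (fun p => chib m j c p [:: A; B]),
      forall c A, weak_L2_cvg (fun k p => eta (gs k) (js k) c p A)
        (fun p => eta m j c p A) &
      forall c A, weak_L2_cvg (fun k p => etab (gs k) (js k) c p A)
        (fun p => etab m j c p A)] /\
  (forall c, weak_L2_cvg (fun k => om (gs k) (js k) c) (om m j c)) /\
  (forall c, weak_L2_cvg (fun k => omb (gs k) (js k) c) (omb m j c)).

Definition sphere : set (R * R * R) :=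
  [set p | p.1.1 ^+ 2 + p.1.2 ^+ 2 + p.2 ^+ 2 = 1].

(* A measurable family, indexed by [0, b], of nonnegative Radon measures on
   (0, a) x S^2. *)
Definition radon_family (a b : R) (nu : R -> {measure set (cylinder R) -> \bar R}) :=
  (forall s, 0 <= s <= b ->
     nu s [set q | ~ (0 < q.1 < a /\ sphere q.2)] = 0%E /\
     forall e : R, 0 < e -> (nu s [set q | (e <= q.1 <= a - e)%R] < +oo)%E) /\
  forall A, measurable A ->
    measurable_fun (`[0, b] : set (measurableTypeR R))
      (fun s => nu s A).

Definition intC (nu : {measure set (cylinder R) -> \bar R})
    (F : R -> bool -> plane R -> R) : R :=
  \int[nu]_q from_charts (F q.1) q.2.

Definition test_cylinder (a : R) (phi : bool -> hpt R -> R) :=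
  [/\ forall c, continuous (phi c),
      forall s, S_scalar (fun c x => phi c (s, x.1, x.2)) &
      exists e : R, 0 < e /\
        forall c q, phi c q != 0 -> e <= q.1.1 <= a - e].

Definition cyl (phi : bool -> hpt R -> R) : R -> bool -> plane R -> R :=
  fun s c x => phi c (s, x.1, x.2).

Definition intH (a : R) (F : bool -> hpt R -> R) : R :=
  \sum_(c : bool)
    \int[leb3 R]_(q in [set q | 0 < q.1.1 < a /\ disc 1 (q.1.2, q.2)]) F c q.

Definition energy_out (g : dnmetric R) (dg : dnjet R) (u : R) phi :=
  intH ubs (fun c q => phi c q * shear_density g (chi g dg) c (outp u q)).

Definition energy_in (g : dnmetric R) (dg : dnjet R) (ub : R) phi :=
  intH us (fun c q => phi c q * shear_density g (chib g dg) c (inp ub q)).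

Definition weak_star_limits (nu nub : R -> {measure set (cylinder R) -> \bar R}) :=
  (forall u phi, 0 <= u <= us -> test_cylinder ubs phi ->
     (fun k => energy_out (gs k) (js k) u phi - energy_out m j u phi) @ \oo
       --> intC (nu u) (cyl phi)) /\
  (forall ub phi, 0 <= ub <= ubs -> test_cylinder us phi ->
     (fun k => energy_in (gs k) (js k) ub phi - energy_in m j ub phi) @ \oo
       --> intC (nub ub) (cyl phi)).

End Convergence.

Section NullDust.
Context {R : realType}.
Variables (us ubs : R) (m : dnmetric R) (j : dnjet R).
Variables nu nub : R -> {measure set (cylinder R) -> \bar R}.

(* d nu = kappa Omega^2 d nu_u du and d nubar = kappa Omega^2 d nubar_ubar dubar *)
Definition int_nu (kappa : R) (F : bool -> pt R -> R) : R :=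
  kappa * \int[leb1 R]_(u in `[0, us])
    intC (nu u) (fun ub c x => F c (mk u ub x) * lap m c (mk u ub x) ^+ 2).

Definition int_nub (kappa : R) (F : bool -> pt R -> R) : R :=
  kappa * \int[leb1 R]_(ub in `[0, ubs])
    intC (nub ub) (fun u c x => F c (mk u ub x) * lap m c (mk u ub x) ^+ 2).

(* The weak form of Ric = d nu (dx^v)^2 + d nubar (dx^w)^2, with
   dx^v . grad (d nu) = 0 = dx^w . grad (d nubar).  The convention (v, w) =
   (u, ubar), kappa = 1 is the one in which the system is usually written down.
   Since dVol_g = 2 Omega^2 du dubar dA_gamma and Ric(e_4, e_4) is the density
   of d nu_u, while e_4 u = 0, the measures arising as limits of |chihat|^2 and
   |chibarhat|^2 obey it with (v, w) = (ubar, u), kappa = 2. *)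
Definition dust_equations (kappa : R) (v w : 'I_4) :=
  (forall X Y, test_field us ubs X -> test_field us ubs Y ->
     ricci_form m j us ubs X Y
     = int_nu kappa (fun c p => X c p v * Y c p v)
       + int_nub kappa (fun c p => X c p w * Y c p w)) /\
  (forall phi, test_function us ubs phi ->
     int_nu kappa (gradc m phi v) = 0 /\ int_nub kappa (gradc m phi w) = 0).

(* C^1 functions on M with compact support in [0, us] x (0, ubs) x S^2,
   respectively in (0, us) x [0, ubs] x S^2. *)
Definition test_transport (t : pt R -> R) (a : R) (phi : bool -> pt R -> R) :=
  [/\ forall c, Ck 1 (phi c), S_function phi &
      exists e : R, 0 < e /\ forall c p, phi c p != 0 -> e <= t p <= a - e].

Definition transport_nu :=
  forall phi u1 u2, test_transport ubof ubs phi ->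
    0 <= u1 -> u1 < u2 -> u2 <= us ->
    intC (nu u2) (fun ub c x => phi c (mk u2 ub x))
    = intC (nu u1) (fun ub c x => phi c (mk u1 ub x))
      + \int[leb1 R]_(u in `[u1, u2]) intC (nu u) (fun ub c x =>
          let p := mk u ub x in
          pd4 iu (phi c) p + \sum_A shf m c p A * pd4 (ith A) (phi c) p).

Definition transport_nub :=
  forall phi ub1 ub2, test_transport uof us phi ->
    0 <= ub1 -> ub1 < ub2 -> ub2 <= ubs ->
    intC (nub ub2) (fun u c x => phi c (mk u ub2 x))
    = intC (nub ub1) (fun u c x => phi c (mk u ub1 x))
      + \int[leb1 R]_(ub in `[ub1, ub2]) intC (nub ub) (fun u c x =>
          pd4 iub (phi c) (mk u ub x)).

Definition weak_null_dust (kappa : R) (v w : 'I_4) :=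
  [/\ dust_equations kappa v w, transport_nu & transport_nub].

End NullDust.

Definition zero_measure {R : realType}
    (mu : {measure set (cylinder R) -> \bar R}) :=
  forall A, measurable A -> mu A = 0%E.

(* Main.v *)
Require Import Defs.
From mathcomp Require Import all_boot all_order all_algebra.
From mathcomp Require Import all_classical all_reals all_analysis.
From mathcomp Require Import measurable_realfun.
From mathcomp Require Import ring lra.

(* The transport equation tested against functions of ubar alone involves neither
   the shift nor its regularity: it says that the integral of phi(ubar) against
   d nu_u does not depend on u.  As d nu_u >= 0, d nu_0 = 0 forces d nu_u = 0 for
   all u, likewise for d nubar, and the right-hand side of the dust equations
   vanishes.  Conversely, if g_infty is vacuum, take X = Y parallel to a
   coordinate field with coefficient a product of cutoffs in u and ubar: the dust
   equations say that an average over u of the integrals of phi(ubar)^2 Omega^2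
   against d nu_u is zero.  Omega is bounded above and below and the unweighted
   integrals do not depend on u, so they all vanish, in particular at u = 0. *)

Set Implicit Arguments.
Unset Strict Implicit.
Unset Printing Implicit Defensive.

Import Order.TTheory GRing.Theory Num.Theory.
Import numFieldNormedType.Exports.

Local Open Scope classical_set_scope.
Local Open Scope ring_scope.

(** * Smooth cutoffs on the line built from exp(-1/t) *)

Section SmoothCutoff.
Context {R : realType}.
Implicit Types (P : {poly R}) (t : R).

(* The derivative of [expinv P] is again some [expinv Q]. *)
Definition expinv P t : R :=
  if 0 < t then P.[t^-1] * expR (- t^-1) else 0.

(** Since exp y = exp (y / n) ^ n >= (1 + y / n) ^ n >= (y / n) ^ n for n > 0; for n = 0 both powers
    are 1. *)
Lemma expr_expRN_bounded n (y : R) : 0 <= y ->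
  y ^+ n * expR (- y) <= n%:R ^+ n.
Proof.
move=> y0; rewrite expRN ler_pdivrMr ?expR_gt0//.
case: n => [|n]; first by rewrite !expr0 mul1r -expR0 ler_expR.
have -> : expR y = expR (y / n.+1%:R) ^+ n.+1.
  by rewrite -expRM_natl mulrCA divff ?mulr1// pnatr_eq0.
rewrite -exprMn lerXn2r ?nnegrE// ?mulr_ge0 ?expR_ge0//.
rewrite -ler_pdivrMl ?ltr0n// mulrC.
by rewrite (le_trans _ (expR_ge1Dx _))// lerDr.
Qed.

Lemma horner_expRN_bounded P :
  exists M, forall y : R, 0 <= y -> `|P.[y] * expR (- y)| <= M.
Proof.
exists (\sum_(i < size P) `|P`_i| * i%:R ^+ i) => y y0.
rewrite horner_coef mulr_suml (le_trans (ler_norm_sum _ _ _))//.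
apply: ler_sum => i _; rewrite -mulrA normrM ler_wpM2l//.
rewrite ger0_norm ?expr_expRN_bounded//.
by rewrite mulr_ge0 ?exprn_ge0 ?expR_ge0.
Qed.

Lemma expinv_bounded P : exists M, forall t, `|expinv P t| <= M.
Proof.
have [M PM] := horner_expRN_bounded P.
exists M => t; rewrite /expinv; case: ifPn => t0.
  by rewrite PM// invr_ge0 ltW.
by rewrite normr0 (le_trans _ (PM 0 _)).
Qed.

(** Meant for the difference quotient at 0: a first use cancels h^-1, a second leaves h times a
    bounded function. *)
Lemma expinv_shift P t : expinv P t = t * expinv ('X * P) t.
Proof.
rewrite /expinv; case: ifPn => t0; last by rewrite mulr0.
by rewrite hornerM hornerX !mulrA divff ?mul1r// gt_eqF.
Qed.

(** For t > 0 put y = 1 / t: differentiating P(y) exp(-y) brings out dy/dt = - y^2, which gives y^2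
    (P - P')(y) exp(-y). For t < 0 the function is locally zero, and at 0 its difference quotient is
    O(h). *)
Lemma is_derive_expinv P t :
  is_derive t 1 (expinv P) (expinv ('X^2 * (P - P^`())) t).
Proof.
case: (ltgtP t 0) => [t0|t0|->].
- have -> : expinv ('X^2 * (P - P^`())) t = 0 by rewrite /expinv ltNge (ltW t0).
  apply: (near_eq_is_derive (f := cst 0)).
  near=> s; rewrite /expinv ltNge.
  suff -> : s <= 0 by [].
  by near: s; exact: lt_le_nbhsl.
- apply: (near_eq_is_derive
    (f := ((horner P) \o GRing.inv) * (expR \o (-%R \o GRing.inv)))).
    near=> s; rewrite /expinv.
    suff -> : 0 < s by [].
    by near: s; exact: lt_nbhsr.
  have dV : is_derive t 1 (@GRing.inv R) (- t ^- 2).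
    have := is_deriveV (lt0r_neq0 t0) (is_derive_id t (1 : R)).
    by rewrite /GRing.scale/= mulr1.
  apply: is_derive_eq.
  rewrite /expinv t0 !hornerE /=.
  by rewrite /GRing.scale /= -exprVn; ring.
- rewrite [X in is_derive _ _ _ X]/expinv ltxx.
  have [M PM] : exists M : R, forall s, `|expinv ('X * ('X * P)) s| <= M.
    exact: expinv_bounded.
  have M0 : 0 <= M := le_trans (normr_ge0 _) (PM 0).
  (* [M] may be 0, so [M + 1] serves as the divisor of [e] below. *)
  have M1 : 0 < M + 1 by rewrite ltr_wpDl.
  have lim0 : (fun h : R => h^-1 *: (expinv P (h *: 1 + 0) - expinv P 0)) @ 0^'
      --> (0 : R).
    apply/cvgr0Pnorm_le => e e0; near=> h.
    have h0 : h != 0 by near: h; exact: nbhs_dnbhs_neq.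
    rewrite addr0 [h *: 1]mulr1 {2}/expinv ltxx subr0.
    rewrite expinv_shift [_ *: _]mulKf// expinv_shift normrM.
    rewrite (@le_trans _ _ (`|h| * (M + 1)))//.
      by rewrite ler_wpM2l// (le_trans (PM h))// lerDl.
    rewrite -ler_pdivlMr//.
    by near: h; apply: dnbhs0_le; exact: divr_gt0.
  by split; [apply/cvg_ex; exists 0|exact/cvg_lim].
Unshelve. all: by end_near. Qed.

Lemma continuous_expinv P : continuous (expinv P).
Proof.
move=> t; apply: differentiable_continuous; apply/derivable1_diffP.
by have [] := is_derive_expinv P t.
Qed.

(** A bump function positive exactly on (e, a - e), identically zero when that interval is empty.
    Each factor is [expinv 1] of a linear form plus a constant, the shape for which smoothness is
    proved below. *)
Definition cutoff (a e t : R) := expinv 1 (t - e) * expinv 1 (- t + (a - e)).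

Lemma expinv1_ge0 t : 0 <= expinv 1 t.
Proof. by rewrite /expinv hornerE mul1r; case: ifPn => // _; exact: expR_ge0. Qed.

Lemma expinv1_gt0 t : (0 < expinv 1 t) = (0 < t).
Proof.
by rewrite /expinv hornerE mul1r; case: ifPn => _; rewrite ?expR_gt0 ?ltxx.
Qed.

Lemma cutoff_ge0 a e t : 0 <= cutoff a e t.
Proof. by rewrite mulr_ge0 ?expinv1_ge0. Qed.

Lemma cutoff_gt0 a e t : (0 < cutoff a e t) = (e < t < a - e).
Proof.
rewrite -[e < t]subr_gt0 -[t < _]subr_gt0 [_ - t]addrC.
rewrite -(expinv1_gt0 (t - e)) -(expinv1_gt0 (- t + _)).
have := expinv1_ge0 (t - e); rewrite /cutoff le_eqVlt => /predU1P[<-|p].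
  by rewrite mul0r ltxx.
by rewrite pmulr_rgt0// p.
Qed.

Lemma cutoff_neq0 a e t : (cutoff a e t != 0) = (e < t < a - e).
Proof. by rewrite -cutoff_gt0 lt0r cutoff_ge0 andbT. Qed.

Lemma continuous_cutoff a e : continuous (cutoff a e).
Proof.
move=> t; apply: cvgM.
- apply: (@continuous_comp _ _ _ (fun s => s - e) (expinv 1)).
    by apply: cvgB; [exact: cvg_id|exact: cvg_cst].
  exact: continuous_expinv.
- apply: (@continuous_comp _ _ _ (fun s => - s + (a - e)) (expinv 1)).
    by apply: cvgD; [apply: cvgN; exact: cvg_id|exact: cvg_cst].
  exact: continuous_expinv.
Qed.

End SmoothCutoff.

(** * Products of smooth functions, and cutoffs of continuous linear forms *)

Section Ck.
Context {R : realType} {V : normedModType R}.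
Implicit Types f g : V -> R.

Lemma Ck_continuous k f : Ck k f -> continuous f.
Proof. by case: k => [|k] []. Qed.

Lemma CkW k f : Ck k.+1 f -> Ck k f.
Proof.
elim: k f => [|k IH] f [cf df]; split=> // v.
by split; [exact: (df v).1|apply: IH; exact: (df v).2].
Qed.

Lemma CkD k f g : Ck k f -> Ck k g -> Ck k (fun x => f x + g x).
Proof.
elim: k f g => [|k IH] f g [cf df] [cg dg]; split=> //.
- by move=> x; apply: cvgD; [exact: cf|exact: cg].
- by move=> x; apply: cvgD; [exact: cf|exact: cg].
move=> v; have [dfv Cf] := df v; have [dgv Cg] := dg v; split.
  by move=> x; exact: derivableD.
rewrite (_ : (fun x => _) = fun x => 'D_v f x + 'D_v g x).
  exact: (IH ('D_v f) ('D_v g)).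
by apply/funext => x; rewrite -deriveD.
Qed.

Lemma CkM k f g : Ck k f -> Ck k g -> Ck k (fun x => f x * g x).
Proof.
elim: k f g => [|k IH] f g [cf df] [cg dg]; split=> //.
- by move=> x; apply: cvgM; [exact: cf|exact: cg].
- by move=> x; apply: cvgM; [exact: cf|exact: cg].
move=> v; have [dfv Cf] := df v; have [dgv Cg] := dg v; split.
  by move=> x; exact: derivableM.
rewrite (_ : (fun x => _) = fun x => f x * 'D_v g x + g x * 'D_v f x).
  by apply: CkD; [apply: (IH f ('D_v g))|apply: (IH g ('D_v f))] => //; exact: CkW.
by apply/funext => x; rewrite -[LHS]/('D_v (f * g) x) deriveM.
Qed.

Lemma smoothM f g : smooth f -> smooth g -> smooth (fun x => f x * g x).
Proof. by move=> sf sg k; exact: CkM. Qed.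

Lemma Ck_cst k (c : R) : Ck k (fun _ : V => c).
Proof.
elim: k c => [|k IH] c; split=> //; try by move=> x; exact: cvg_cst.
move=> v; split; first by move=> x; exact: derivable_cst.
have -> : (fun x => 'D_v (fun _ : V => c) x) = fun=> 0.
  by apply/funext => x; exact: derive_cst.
exact: IH.
Qed.

Lemma smooth_cst (c : R) : smooth (fun _ : V => c).
Proof. by move=> k; exact: Ck_cst. Qed.

Variable l : V -> R.
Hypothesis l_linear : forall h v x, l (h *: v + x) = h * l v + l x.
Hypothesis l_continuous : continuous l.

(** On the line through [x] in the direction [v] the argument is an affine function [q] of the
    parameter with slope [l v], so the one-variable chain rule applies. Absorbing the slope into the
    polynomial keeps the derivative in the same class. *)
Lemma is_derive_expinv_linear P (c : R) v x :
  is_derive x v (fun y => expinv P (l y + c))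
    (expinv ((l v)%:P * ('X^2 * (P - P^`()))) (l x + c)).
Proof.
pose q (h : R) := l v * h + (l x + c).
have dq : is_derive (0 : R) 1 q (l v).
  by apply: is_derive_eq; rewrite /GRing.scale/= mulr1 addr0.
have q0 : q 0 = l x + c by rewrite /q mulr0 add0r.
have := @is_derive1_comp _ (expinv P) q 0 _ _ (is_derive_expinv P (q 0)) dq.
set D := _ * l v => -[dE DE].
have E : (fun h : R => expinv P (l (h *: v + x) + c)) = expinv P \o q.
  by apply/funext => h; rewrite /q /= l_linear addrA [h * _]mulrC.
split; first by apply/derivable1P; rewrite E.
(* The difference quotient along [v] at [x] coincides, for every increment, with that of
   [expinv P \o q] at 0. *)
transitivity ('D_1 (expinv P \o q) 0).
  rewrite -E /derive; set g1 := fun h => h^-1 *: _; set g2 := fun h => h^-1 *: _.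
  suff -> : g1 = g2 by [].
  by apply/funext => h; rewrite /g1 /g2/= addr0 scale0r add0r [_%:A]mulr1.
rewrite DE /D q0 /expinv; case: ifPn => _; rewrite ?mul0r//.
by rewrite [in RHS]hornerM hornerC mulrC mulrA.
Qed.

(** Induction on the order with [P] generalized: each directional derivative is a function of the
    same form with another polynomial. *)
Lemma smooth_expinv_linear P (c : R) : smooth (fun x => expinv P (l x + c)).
Proof.
move=> k; elim: k P => [|k IH] P.
  split=> // x; apply: (@continuous_comp _ _ _ (fun x => l x + c) (expinv P)).
    by apply: cvgD; [exact: l_continuous|exact: cvg_cst].
  exact: continuous_expinv.
split; first exact: Ck_continuous (IH P).
move=> v; split=> [x|]; first by have [] := is_derive_expinv_linear P c v x.
have -> : (fun x => 'D_v (fun y => expinv P (l y + c)) x) =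
    fun x => expinv ((l v)%:P * ('X^2 * (P - P^`()))) (l x + c).
  by apply/funext => x; have [] := is_derive_expinv_linear P c v x.
exact: IH.
Qed.

End Ck.

Lemma smooth_cutoff (R : realType) (V : normedModType R) (l : V -> R) (a e : R) :
  (forall h v x, l (h *: v + x) = h * l v + l x) -> continuous l ->
  smooth (fun x => cutoff a e (l x)).
Proof.
move=> ll lc; apply: smoothM; first exact: smooth_expinv_linear.
apply: (@smooth_expinv_linear _ _ (fun x => - l x)).
  by move=> h v x; rewrite ll opprD mulrN.
by move=> x; apply: cvgN; exact: lc.
Qed.

(** * Comparison of integrals of nonnegative functions *)

Section NonnegativeIntegrals.
Context d (T : measurableType d) {R : realType}.
Variable mu : {measure set T -> \bar R}.
Local Open Scope ereal_scope.
Import HBNNSimple.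

(* No measurability of [f] or [g] is assumed, so that neither the chartwise
   integrands nor the slice integrals [s |-> intC (nu s) _] need be measurable. *)
Lemma ge0_le_integral_off_null (D N : set T) (f g : T -> \bar R) :
  measurable N -> mu N = 0 ->
  (forall x, D x -> 0 <= f x) -> (forall x, D x -> 0 <= g x) ->
  (forall x, D x -> ~ N x -> f x <= g x) ->
  \int[mu]_(x in D) f x <= \int[mu]_(x in D) g x.
Proof.
move=> mN N0 f0 g0 fg; rewrite !ge0_integralE//.
apply: ge_ereal_sup => _ [h hf <-].
(* A simple function [h] below [f] is set to 0 on [N]. Its integral is unchanged because [N] is
   null, and the result is below [g]: off [N] since [f <= g] there, on [N] since [g] is
   nonnegative. *)
pose h' := proj_nnsfun h (measurableC mN).
have -> : sintegral mu h = sintegral mu h'.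
  have I (k : {nnsfun T >-> R}) : sintegral mu k = \int[mu]_x (k x)%:E.
    by rewrite integral_nnsfun// patch_setT.
  rewrite !I; apply: ge0_ae_eq_integral => //.
  - by apply/measurable_EFinP; exact: measurable_funP.
  - by apply/measurable_EFinP; exact: measurable_funP.
  - by move=> x _; rewrite lee_fin.
  - by move=> x _; rewrite lee_fin.
  exists N; split=> // x /= xN; apply: contrapT => Nx; apply: xN => _.
  by rewrite /= mindicE mem_set// mulr1.
apply: ereal_sup_ubound; exists h' => // x /=.
rewrite mindicE; have [xN|xN] := boolP (x \in ~` N).
  rewrite mulr1 (le_trans (hf x))// !patchE; case: ifPn => // xD.
  by apply: fg; [exact: set_mem|exact: set_mem xN].
rewrite mulr0 patchE; case: ifPn => // xD.
by apply: g0; exact: set_mem.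
Qed.

(** Measures agreeing on measurable sets have the same integrals, so [mu] can be replaced by [mzero]
    for an arbitrary integrand. *)
Lemma Rintegral_zero_measure (D : set T) (f : T -> R) :
  (forall A, measurable A -> mu A = 0) -> (\int[mu]_(x in D) f x)%R = 0%R.
Proof.
move=> mu0; rewrite /Rintegral.
have -> : \int[mu]_(x in D) (f x)%:E = \int[mzero]_(x in D) (f x)%:E.
  by apply: eq_measure_integral => A mA _; exact: mu0.
by rewrite integral_measure_zero.
Qed.

End NonnegativeIntegrals.

(** * Measures on the cylinder (0, a) x S^2 *)

Section CylinderMeasures.
Context {R : realType}.
Implicit Types (mu : {measure set (cylinder R) -> \bar R}) (G : R -> R).

Definition outside_cylinder (a : R) : set (cylinder R) :=
  [set q | ~ (0 < q.1 < a /\ sphere q.2)].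

(** For z <= 0 the stereographic image has squared norm (1 - z^2) / (1 - z)^2 = (1 + z) / (1 - z) <=
    1, and symmetrically for z > 0. Bounds over the two closed unit discs therefore control
    [from_charts] on the whole sphere. *)
Lemma from_charts_disc (p : R * R * R) : sphere p ->
  exists2 y : bool * plane R, disc 1 y.2 &
    forall F, from_charts F p = F y.1 y.2.
Proof.
case: p => [[x y] z]; rewrite /sphere/= => S; have [z0|z0] := leP z 0.
  exists (true, (x / (1 - z), y / (1 - z))) => [|F].
    rewrite /disc /normsq/= !exprMn -mulrDl exprVn ler_pdivrMr; first nra.
    by rewrite exprn_gt0//; lra.
  by rewrite /from_charts/= z0.
exists (false, (x / (1 + z), y / (1 + z))) => [|F].
  rewrite /disc /normsq/= !exprMn -mulrDl exprVn ler_pdivrMr; first nra.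
  by rewrite exprn_gt0//; lra.
by rewrite /from_charts/= leNgt z0.
Qed.

Lemma measurable_outside_cylinder a : measurable (outside_cylinder a).
Proof.
rewrite /outside_cylinder.
have -> : [set q : cylinder R | ~ (0 < q.1 < a /\ sphere q.2)] =
    ~` ((fst @^-1` `]0, a[%classic) `&`
       ((fun q : cylinder R => q.2.1.1 ^+ 2 + q.2.1.2 ^+ 2 + q.2.2 ^+ 2)
         @^-1` [set 1])).
  by apply/seteqP; split => q /=; rewrite in_itv.
apply: measurableC; apply: measurableI.
  by rewrite -[X in measurable X]setTI; exact: measurable_fst.
rewrite -[X in measurable X]setTI.
have mf : measurable_fun [set: cylinder R]
    (fun q => q.2.1.1 ^+ 2 + q.2.1.2 ^+ 2 + q.2.2 ^+ 2).
  apply: measurable_funD; first apply: measurable_funD.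
  - apply: measurable_funX; apply: (measurableT_comp measurable_fst).
    exact: (measurableT_comp measurable_fst measurable_snd).
  - apply: measurable_funX; apply: (measurableT_comp measurable_snd).
    exact: (measurableT_comp measurable_fst measurable_snd).
  - apply: measurable_funX.
    exact: (measurableT_comp measurable_snd measurable_snd).
exact: mf.
Qed.

Lemma intC_cst mu G :
  intC mu (fun t _ _ => G t) = fine (\int[mu]_q (G q.1)%:E).
Proof.
rewrite /intC /Rintegral; congr (fine _); apply: eq_integral => q _.
by rewrite /from_charts if_same.
Qed.

Lemma measurable_fst_continuous G : continuous G ->
  measurable_fun [set: cylinder R] (fun q => G q.1).
Proof.
move=> cG; apply: (@measurableT_comp _ _ _ _ _ _ G _ fst).
  exact: continuous_measurable_fun.
exact: measurable_fst.
Qed.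

(** Off the null set [outside_cylinder a] every point is read in a closed unit disc, where the
    bounds on [F] hold. The integrals are compared as extended reals; finiteness for [G] then
    permits taking [fine], which would send +oo to 0. *)
Lemma intC_sandwich (a c C : R) mu (F : R -> bool -> plane R -> R) G :
  mu (outside_cylinder a) = 0%E -> 0 <= c -> 0 <= C -> continuous G ->
  (forall t, 0 <= G t) -> (forall t ch x, 0 <= F t ch x) ->
  (forall t ch x, 0 < t < a -> disc 1 x -> c * G t <= F t ch x <= C * G t) ->
  (\int[mu]_q (G q.1)%:E < +oo)%E ->
  c * intC mu (fun t _ _ => G t) <= intC mu F <= C * intC mu (fun t _ _ => G t).
Proof.
move=> mu0 c0 C0 cG G0 F0 FG Goo.
have mG : measurable_fun [set: cylinder R] (fun q => (G q.1)%:E).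
  by apply/measurable_EFinP; exact: measurable_fst_continuous.
have scale k : 0 <= k ->
    (\int[mu]_q (k * G q.1)%:E = k%:E * \int[mu]_q (G q.1)%:E)%E.
  move=> k0; rewrite -ge0_integralZl_EFin// => q _.
  by rewrite lee_fin.
have FC0 q : 0 <= from_charts (F q.1) q.2 by rewrite /from_charts; case: ifPn.
have inside (q : cylinder R) : ~ outside_cylinder a q ->
    c * G q.1 <= from_charts (F q.1) q.2 <= C * G q.1.
  move=> /contrapT[q1 /from_charts_disc[y y1 ->]]; exact: FG.
have lo : (c%:E * \int[mu]_q (G q.1)%:E <=
    \int[mu]_q (from_charts (F q.1) q.2)%:E)%E.
  rewrite -scale//.
  apply: (ge0_le_integral_off_null (measurable_outside_cylinder a)) => //=.
  - by move=> q _; rewrite lee_fin mulr_ge0.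
  - by move=> q _; rewrite lee_fin.
  - by move=> q _ /inside/andP[? _]; rewrite lee_fin.
have hi : (\int[mu]_q (from_charts (F q.1) q.2)%:E <=
    C%:E * \int[mu]_q (G q.1)%:E)%E.
  rewrite -scale//.
  apply: (ge0_le_integral_off_null (measurable_outside_cylinder a)) => //=.
  - by move=> q _; rewrite lee_fin.
  - by move=> q _; rewrite lee_fin mulr_ge0.
  - by move=> q _ /inside/andP[_ ?]; rewrite lee_fin.
have I0 : (0 <= \int[mu]_q (G q.1)%:E)%E.
  by apply: integral_ge0 => q _; rewrite lee_fin.
have J0 : (0 <= \int[mu]_q (from_charts (F q.1) q.2)%:E)%E.
  by apply: integral_ge0 => q _; rewrite lee_fin.
rewrite intC_cst /intC /Rintegral.
move: I0 J0 Goo lo hi.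
case: (\int[mu]_q (G q.1)%:E)%E => [r| |]// _.
case: (\int[mu]_q (from_charts (F q.1) q.2)%:E)%E => [s| |]//= _ _.
by rewrite -!EFinM !lee_fin => -> ->.
Qed.

(** The cutoff is bounded and vanishes off the slab e <= t <= a - e, whose mass is finite. *)
Lemma integral_cutoff_sqr_lty (a e : R) mu :
  (mu [set q | (e <= q.1 <= a - e)%R] < +oo)%E ->
  (\int[mu]_q (cutoff a e q.1 ^+ 2)%:E < +oo)%E.
Proof.
move=> muoo.
have [M1 PM1] := expinv_bounded (1 : {poly R}).
have M0 : 0 <= M1 := le_trans (normr_ge0 _) (PM1 0).
set S := [set q : cylinder R | (e <= q.1 <= a - e)%R] in muoo.
have mS : measurable S.
  rewrite (_ : S = [set: cylinder R] `&` fst @^-1` `[e, a - e]%classic).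
    exact: measurable_fst.
  by rewrite setTI; apply/seteqP; split => q; rewrite /S/= in_itv.
pose M := (M1 * M1) ^+ 2.
have le1 : (\int[mu]_q (cutoff a e q.1 ^+ 2)%:E <=
   \int[mu]_q (M%:E * (\1_S q)%:E))%E.
  apply: (@ge0_le_integral_off_null _ _ _ _ _ set0) => //.
  - by move=> q _; rewrite lee_fin sqr_ge0.
  - by move=> q _; rewrite mule_ge0// lee_fin ?sqr_ge0.
  move=> q _ _; rewrite -EFinM lee_fin indicE.
  have [qS|qS] := boolP (q \in S).
    rewrite mulr1 /M lerXn2r ?nnegrE ?cutoff_ge0 ?mulr_ge0//.
    by rewrite ler_pM ?expinv1_ge0// -[expinv _ _]ger0_norm ?expinv1_ge0.
  rewrite mulr0 (_ : cutoff a e q.1 = 0) ?expr0n//.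
  apply/eqP; apply: contraNT qS; rewrite cutoff_neq0 => /andP[q1 q2].
  by rewrite inE /S/= !ltW.
apply: (le_lt_trans le1).
rewrite ge0_integralZl_EFin ?sqr_ge0//; last first.
  by apply/measurable_EFinP; exact: measurable_indic.
rewrite integral_indic// setIT.
move: muoo; have : (0 <= mu S)%E by [].
by case: (mu S) => [r| |]//= _ _; rewrite ltry.
Qed.

(** A nonnegative function with zero integral vanishes almost everywhere, so the set where a cutoff
    is nonzero is negligible. For e = 1 / (n + 1) these countably many sets exhaust the cylinder.
    Finiteness ensures that the zero value of [intC], a [fine], is a true zero integral. *)
Lemma zero_measure_cutoff (a : R) mu :
  mu (outside_cylinder a) = 0%E ->
  (forall e, 0 < e -> (mu [set q | (e <= q.1 <= a - e)%R] < +oo)%E) ->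
  (forall e, 0 < e -> intC mu (fun t _ _ => cutoff a e t ^+ 2) = 0) ->
  zero_measure mu.
Proof.
move=> mu0 fin I0.
pose S n := [set q : cylinder R | cutoff a n.+1%:R^-1 q.1 != 0].
have Sneg n : mu.-negligible (S n).
  have e0 : (0 : R) < n.+1%:R^-1 by rewrite invr_gt0.
  have := I0 _ e0; rewrite intC_cst.
  have := integral_cutoff_sqr_lty (fin _ e0).
  set I := (\int[mu]_q _)%E => Ioo I00.
  have {I00} : I = 0%E.
    have : (0 <= I)%E by apply: integral_ge0 => q _; rewrite lee_fin sqr_ge0.
    by move: Ioo I00; case: (I) => [r| |]//= _ ->.
  have mb : measurable_fun [set: cylinder R]
      (fun q => (cutoff a n.+1%:R^-1 q.1 ^+ 2)%:E).
    apply/measurable_EFinP; apply: measurable_funX.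
    by apply: measurable_fst_continuous; exact: continuous_cutoff.
  have -> : I = (\int[mu]_q `|(cutoff a n.+1%:R^-1 q.1 ^+ 2)%:E|)%E.
    by apply: eq_integral => q _; rewrite gee0_abs// lee_fin sqr_ge0.
  move=> /(ae_eq_integral_abs _ measurableT mb)[N [mN N0 sN]].
  exists N; split=> // q Sq; apply: sN => /= /(_ Logic.I)[] /eqP.
  by rewrite sqrf_eq0 (negPf Sq).
have neg : mu.-negligible (outside_cylinder a `|` \bigcup_n S n).
  apply: negligibleU; last exact: negligible_bigcup.
  by apply/negligibleP => //; exact: measurable_outside_cylinder.
move=> A mA; apply: measure_negligible => //; apply: negligibleS neg.
move=> q _; have [|/contrapT[/andP[q0 qa] _]] := pselect (outside_cylinder a q).
  by left.
right.
(* An n with 1 / (n + 1) below the distance of [q.1] to both endpoints puts [q] in [S n]. *)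
have m0 : 0 < Num.min q.1 (a - q.1) by rewrite lt_min q0 subr_gt0.
have [n _ /(_ _ (leqnn n))] := near_infty_natSinv_lt (PosNum m0).
rewrite /= lt_min => /andP[n1 n2]; exists n => //.
by rewrite /S/= cutoff_neq0 n1/= ltrBrDr -ltrBrDl.
Qed.

End CylinderMeasures.

(** * Functions constant along a line, and averages of a family of measures over its parameter *)

Lemma derive_const_along (R : realType) (V : normedModType R) (f : V -> R)
    (v x : V) :
  (forall h, f (h *: v + x) = f x) -> 'D_v f x = 0.
Proof.
move=> fv; rewrite /derive; apply/cvg_lim => //.
rewrite (_ : (fun h => _) = fun=> 0); first exact: cvg_cst.
by apply/funext => h /=; rewrite fv subrr scaler0.
Qed.

(** Were the integral 0, the cutoff would vanish almost everywhere on [0, b], yet it is nonzero on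
    (e, b - e), an interval of positive length. *)
Lemma lebesgue_cutoff_sqr_gt0 (R : realType) (b e : R) : 0 < e -> e < b - e ->
  (0 < \int[leb1 R]_(s in `[0%R, b]) (cutoff b e s ^+ 2)%:E)%E.
Proof.
move=> e0 eb; set I := (\int[_]_(s in _) _)%E.
have : (0 <= I)%E by apply: integral_ge0 => s _; rewrite lee_fin sqr_ge0.
rewrite le_eqVlt => /predU1P[/esym|//].
have -> : I = (\int[leb1 R]_(s in `[0%R, b]) `|(cutoff b e s ^+ 2)%:E|)%E.
  by apply: eq_integral => s _; rewrite gee0_abs// lee_fin sqr_ge0.
have mc : measurable_fun (`[0, b] : set R) (fun s => (cutoff b e s ^+ 2)%:E).
  apply/measurable_EFinP; apply: measurable_funX; apply: measurable_funTS.
  by apply: continuous_measurable_fun; exact: continuous_cutoff.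
have [Bae _] := ae_eq_integral_abs (leb1 R) (measurable_itv `[0, b]) mc.
move=> /Bae[N [mN N0 sN]].
have : (leb1 R `]e, (b - e)%R[%classic <= leb1 R N)%E.
  apply: le_measure; rewrite ?inE//= => s; rewrite /= in_itv/= => /andP[es se].
  apply: sN => /= Bs; have : cutoff b e s != 0 by rewrite cutoff_neq0 es.
  have sb : `[0, b]%classic s by rewrite /= in_itv/=; apply/andP; split; lra.
  by move/negP; apply; rewrite -sqrf_eq0; apply/eqP; have [] := Bs sb.
rewrite N0 lebesgue_measure_itv/= lte_fin eb -EFinB lee_fin.
by rewrite leNgt subr_gt0 eb.
Qed.

Lemma lebesgue_cutoff_sqr_lty (R : realType) (b e : R) :
  (\int[leb1 R]_(s in `[0%R, b]) (cutoff b e s ^+ 2)%:E < +oo)%E.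
Proof.
have : (leb1 R).-integrable `[0, b] (EFin \o (fun s => cutoff b e s ^+ 2)).
  apply: continuous_compact_integrable; first exact: segment_compact.
  apply: continuous_subspaceT => s.
  by apply: cvgM; exact: continuous_cutoff.
move=> /integrableP[_]; congr (_ < _)%E.
by apply: eq_integral => s _ /=; rewrite ger0_norm ?sqr_ge0.
Qed.

(* The mass of [G] is the same constant [K] on every slice, so the vanishing
   of its average against a positive density forces [K = 0]. *)
Lemma weighted_family_zero (R : realType) (a b e c C K : R)
    (nu : R -> {measure set (cylinder R) -> \bar R}) (G : R -> R)
    (W : R -> R -> bool -> plane R -> R) :
  0 < e -> e < b - e -> 0 < c -> 0 <= C -> continuous G -> (forall t, 0 <= G t) ->
  (forall s, 0 <= s <= b -> nu s (outside_cylinder a) = 0%E) ->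
  (forall s, 0 <= s <= b -> (\int[nu s]_q (G q.1)%:E < +oo)%E) ->
  (forall s, 0 <= s <= b -> intC (nu s) (fun t _ _ => G t) = K) ->
  (forall s t ch x, 0 <= W s t ch x) ->
  (forall s t ch x, 0 <= s <= b -> 0 < t < a -> disc 1 x ->
     c <= W s t ch x <= C) ->
  \int[leb1 R]_(s in `[0, b])
    intC (nu s) (fun t ch x => cutoff b e s ^+ 2 * G t * W s t ch x) = 0 ->
  K = 0.
Proof.
move=> e0 eb c0 C0 cG G0 nu0 Goo GK W0 cWC.
set B := fun s => cutoff b e s ^+ 2.
have B0 s : 0 <= B s by exact: sqr_ge0.
pose J s := intC (nu s) (fun t ch x => B s * G t * W s t ch x).
(* For fixed [s] the weight [B s] is a constant, so the sandwich applies with the constants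
   [c * B s] and [C * B s]. *)
have JK s : 0 <= s <= b -> c * K * B s <= J s <= C * K * B s.
  move=> sb; rewrite -(GK s sb) ![_ * _ * B s]mulrAC.
  apply: (intC_sandwich (a := a) (nu0 s sb)) => //; last exact: Goo.
  - by rewrite mulr_ge0// ltW.
  - by rewrite mulr_ge0.
  - by move=> t ch x; rewrite mulr_ge0// mulr_ge0.
  move=> t ch x ta dx; have /andP[cW WC] := cWC s t ch x sb ta dx.
  have BG : 0 <= B s * G t by rewrite mulr_ge0.
  by rewrite -(mulrA c) -(mulrA C) [_ * W _ _ _ _]mulrC !ler_wpM2r.
have K0 : 0 <= K.
  rewrite -(GK 0) ?lexx; last lra.
  by rewrite intC_cst fine_ge0// integral_ge0// => q _; rewrite lee_fin.
have scale k : 0 <= k -> (\int[leb1 R]_(s in `[0%R, b]) (k * B s)%:E =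
    k%:E * \int[leb1 R]_(s in `[0%R, b]) (B s)%:E)%E.
  move=> k0; rewrite -ge0_integralZl_EFin//.
  - by move=> s _; rewrite lee_fin.
  - apply/measurable_EFinP; apply: measurable_funX; apply: measurable_funTS.
    by apply: continuous_measurable_fun; exact: continuous_cutoff.
have lo0 s : 0 <= c * K * B s by exact: mulr_ge0 (mulr_ge0 (ltW c0) K0) (B0 s).
have hi0 s : 0 <= C * K * B s by exact: mulr_ge0 (mulr_ge0 C0 K0) (B0 s).
have lo : ((c * K)%:E * \int[leb1 R]_(s in `[0%R, b]) (B s)%:E <=
    \int[leb1 R]_(s in `[0%R, b]) (J s)%:E)%E.
  rewrite -scale; last by rewrite mulr_ge0// ltW.
  apply: (@ge0_le_integral_off_null _ _ _ _ _ set0) => //= s;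
    rewrite in_itv/= => sb; have /andP[cJ _] := JK s sb.
  - by rewrite lee_fin.
  - by rewrite lee_fin (le_trans (lo0 s)).
  - by move=> _; rewrite lee_fin.
(* The upper bound excludes the value +oo, whose [fine] is also 0; the lower bound then yields the
   contradiction with K > 0. *)
have hi : (\int[leb1 R]_(s in `[0%R, b]) (J s)%:E <=
    (C * K)%:E * \int[leb1 R]_(s in `[0%R, b]) (B s)%:E)%E.
  rewrite -scale; last by rewrite mulr_ge0.
  apply: (@ge0_le_integral_off_null _ _ _ _ _ set0) => //= s;
    rewrite in_itv/= => sb; have /andP[cJ JC] := JK s sb.
  - by rewrite lee_fin (le_trans (lo0 s)).
  - by rewrite lee_fin.
  - by move=> _; rewrite lee_fin.
rewrite /Rintegral.
change (fine (\int[leb1 R]_(s in `[0%R, b]) (J s)%:E)%E = 0 -> K = 0).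
move: lo hi (lebesgue_cutoff_sqr_gt0 e0 eb) (lebesgue_cutoff_sqr_lty b e).
rewrite -/B.
case: (\int[leb1 R]_(s in `[0%R, b]) (B s)%:E)%E => [r| |]//.
case: (\int[leb1 R]_(s in `[0%R, b]) (J s)%:E)%E => [j| |]//=.
rewrite -!EFinM !lee_fin lte_fin => lo _ r0 _ j0.
apply/eqP; rewrite eq_le K0 andbT leNgt; apply/negP => Kgt.
by move: lo; rewrite j0 leNgt !mulr_gt0.
Qed.

Lemma intC0 (R : realType) (mu : {measure set (cylinder R) -> \bar R}) :
  intC mu (fun _ _ _ => 0) = 0.
Proof. by rewrite (intC_cst mu (fun=> 0)) integral0. Qed.

(** * Conserved masses, bounds on the lapse, and radial test fields *)

Section NullDustMeasures.
Context {R : realType}.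
Variables (us ubs : R) (m : dnmetric R) (j : dnjet R).
Variables nu nub : R -> {measure set (cylinder R) -> \bar R}.

Lemma uof_linear h (v x : pt R) : uof (h *: v + x) = h * uof v + uof x.
Proof. by []. Qed.

Lemma ubof_linear h (v x : pt R) : ubof (h *: v + x) = h * ubof v + ubof x.
Proof. by []. Qed.

Lemma continuous_uof : continuous (@uof R).
Proof.
move=> p; apply: (@continuous_comp _ _ _ (fun p : pt R => p.1.1) fst).
  apply: (@continuous_comp _ _ _ (fun p : pt R => p.1) fst).
    exact: cvg_fst.
  exact: cvg_fst.
exact: cvg_fst.
Qed.

Lemma continuous_ubof : continuous (@ubof R).
Proof.
move=> p; apply: (@continuous_comp _ _ _ (fun p : pt R => p.1.1) snd).
  apply: (@continuous_comp _ _ _ (fun p : pt R => p.1) fst).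
    exact: cvg_fst.
  exact: cvg_fst.
exact: cvg_snd.
Qed.

Lemma smooth_cutoff_sqr (l : pt R -> R) (a e : R) :
  (forall h v x, l (h *: v + x) = h * l v + l x) -> continuous l ->
  smooth (fun p => cutoff a e (l p) ^+ 2).
Proof. by move=> ll lc; apply: smoothM; exact: smooth_cutoff. Qed.

Lemma cutoff_sqr_neq0 (a e t : R) : cutoff a e t ^+ 2 != 0 -> e <= t <= a - e.
Proof.
by rewrite sqrf_eq0 cutoff_neq0 => /andP[et te]; rewrite !ltW.
Qed.

(* Radial test functions see neither the shift nor the direction of transport,
   so the transport equation conserves the mass they measure. *)
Lemma transport_nu_cutoff (e u : R) : transport_nu us ubs m nu -> 0 < e ->
  0 <= u <= us ->
  intC (nu u) (fun t _ _ => cutoff ubs e t ^+ 2) =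
  intC (nu 0) (fun t _ _ => cutoff ubs e t ^+ 2).
Proof.
move=> tr e0 /andP[]; rewrite le_eqVlt => /predU1P[<-//|u0] us1.
pose phi (c : bool) (p : pt R) := cutoff ubs e (ubof p) ^+ 2.
have phi_test : test_transport ubof ubs phi.
  split=> // [c|].
    exact: (@smooth_cutoff_sqr _ ubs e ubof_linear continuous_ubof 1).
  by exists e; split=> // c p; exact: cutoff_sqr_neq0.
have -> := tr phi 0 u phi_test (lexx 0) u0 us1.
rewrite [X in _ + X](_ : _ = 0) ?addr0//.
have d0 i c p : i != iub -> pd4 i (phi c) p = 0.
  move=> ii; apply: derive_const_along => h; rewrite /phi ubof_linear.
  have -> : ubof (cbasis i : pt R) = 0.
    by rewrite /ubof/= (_ : (i == 1 :> nat) = false)//; exact: negbTE ii.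
  by rewrite mulr0 add0r.
rewrite (@eq_Rintegral _ _ _ _ _ (fun=> 0)) => [|s _].
  by rewrite /Rintegral integral0.
rewrite -[RHS](intC0 (nu s)); congr intC; apply/funext => t; apply/funext => c.
apply/funext => x /=; rewrite d0// add0r big1// => A _.
by rewrite d0 ?mulr0//; apply/eqP => /(congr1 val).
Qed.

(** Here the transport is along d_ubar without shift, and a cutoff in u is constant in that
    direction. *)
Lemma transport_nub_cutoff (e ub : R) : transport_nub us ubs nub -> 0 < e ->
  0 <= ub <= ubs ->
  intC (nub ub) (fun t _ _ => cutoff us e t ^+ 2) =
  intC (nub 0) (fun t _ _ => cutoff us e t ^+ 2).
Proof.
move=> tr e0 /andP[]; rewrite le_eqVlt => /predU1P[<-//|ub0] ub1.
pose phi (c : bool) (p : pt R) := cutoff us e (uof p) ^+ 2.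
have phi_test : test_transport uof us phi.
  split=> // [c|].
    exact: (@smooth_cutoff_sqr _ us e uof_linear continuous_uof 1).
  by exists e; split=> // c p; exact: cutoff_sqr_neq0.
have -> := tr phi 0 ub phi_test (lexx 0) ub0 ub1.
rewrite [X in _ + X](_ : _ = 0) ?addr0//.
rewrite (@eq_Rintegral _ _ _ _ _ (fun=> 0)) => [|s _].
  by rewrite /Rintegral integral0.
rewrite -[RHS](intC0 (nub s)); congr intC; apply/funext => t; apply/funext => c.
apply/funext => x; apply: derive_const_along => h; rewrite /phi uof_linear.
by rewrite [uof (cbasis _)]/= mulr0 add0r.
Qed.

(** The closed unit disc lies in the square [-1, 1]^2, so a product of segments is a compact box on
    which the continuous positive lapse attains its extrema. The constants of the two charts are
    combined by [min] and [max]. *)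
Lemma lap_sqr_bounds : 0 <= us -> 0 <= ubs -> dn_metric us ubs m ->
  (forall c, {within chartM us ubs, continuous (lap m c)}) ->
  exists c C, [/\ 0 < c, 0 <= C & forall u ub ch x,
    0 <= u <= us -> 0 <= ub <= ubs -> disc 1 x ->
    c <= lap m ch (mk u ub x) ^+ 2 <= C].
Proof.
move=> us0 ubs0 mm lc.
pose box : set (pt R) := `[0, us] `*` `[0, ubs] `*` `[-1, 1] `*` `[-1, 1].
have cbox : compact box by do !apply: compact_setX; exact: segment_compact.
have box_chart : box `<=` chartM us ubs.
  by move=> p [[[]]] /=; rewrite !in_itv.
have box0 : box !=set0.
  by exists (0, 0, 0, 0); rewrite /box/= !in_itv/= !lexx us0 ubs0 lerN10 ler01.
have disc_box u ub x : 0 <= u <= us -> 0 <= ub <= ubs -> disc 1 x ->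
    mk u ub x \in box.
  move=> ui ubi; rewrite /disc/= /normsq => dx.
  have unit_itv (t t' : R) : t ^+ 2 + t' ^+ 2 <= 1 ^+ 2 -> `[-1, 1]%classic t.
    by move=> tt'; rewrite /= in_itv/=; apply/andP; split; nra.
  rewrite inE; split; [split; [split|]|]; rewrite /= ?in_itv//=.
    exact: unit_itv dx.
  by apply: unit_itv; rewrite addrC; exact: dx.
have lcb c : {within box, continuous (lap m c)}.
  exact: continuous_subspaceW box_chart (lc c).
have lap_gt0 c p : p \in box -> 0 < lap m c p.
  move=> /set_mem/box_chart[pu pub].
  have [_ _ /(_ c (xof p)) + _] := mm _ _ pu pub.
  by case: p pu pub => [[[]]].
have bnd ch : exists c C, [/\ 0 < c, 0 <= C &
    forall p, p \in box -> c <= lap m ch p ^+ 2 <= C].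
  have [p pb pmin] := compact_EVT_min box0 cbox (lcb ch).
  have [q qb qmax] := compact_EVT_max box0 cbox (lcb ch).
  exists (lap m ch p ^+ 2), (lap m ch q ^+ 2); split=> [||r rb].
  - by rewrite exprn_gt0// lap_gt0.
  - exact: sqr_ge0.
  - by apply/andP; split; rewrite lerXn2r ?nnegrE ?pmin ?qmax// ltW ?lap_gt0.
have [c1 [C1 [c10 C10 cC1]]] := bnd true.
have [c2 [C2 [c20 C20 cC2]]] := bnd false.
exists (Num.min c1 c2), (Num.max C1 C2); split=> [||u ub ch x ui ubi dx].
- by rewrite lt_min c10.
- by rewrite le_max C10.
rewrite ge_min le_max; have xb := disc_box u ub x ui ubi dx.
have /andP[l1 h1] := cC1 _ xb; have /andP[l2 h2] := cC2 _ xb.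
by case: ch; rewrite ?l1 ?h1 ?l2 ?h2 ?orbT.
Qed.

Definition radial_field (v : 'I_4) (e' e : R) (c : bool) (p : pt R)
    (a : 'I_4) : R :=
  if a == v then cutoff us e' (uof p) * cutoff ubs e (ubof p) else 0.

(** The coefficient is the same function of u and ubar in both charts and the sphere components
    vanish, so the transformation laws are trivial; the smaller of the two margins bounds the
    support. *)
Lemma test_radial_field v e' e : 0 < e' -> 0 < e -> v = iu \/ v = iub ->
  test_field us ubs (radial_field v e' e).
Proof.
move=> e'0 e0 vE; split.
- move=> c a; rewrite /radial_field; case: (a == v); last exact: smooth_cst.
  apply: smoothM.
    exact: (smooth_cutoff _ _ uof_linear continuous_uof).
  exact: (smooth_cutoff _ _ ubof_linear continuous_ubof).
- by [].
- by [].
- have N A : (ith A == v) = false.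
    by case: vE => ->; apply/eqP => /(congr1 val).
  move=> u ub c x A _; rewrite /radial_field N big1// => B _.
  by rewrite N mulr0.
move=> a; exists (Num.min e' e); split; first by rewrite lt_min e'0.
move=> c p; rewrite /radial_field; case: ifPn => _; last by rewrite eqxx.
rewrite mulf_eq0 negb_or !cutoff_neq0 => /andP[/andP[u1 u2] /andP[ub1 ub2]].
have m1 : Num.min e' e <= e' by rewrite ge_min lexx.
have m2 : Num.min e' e <= e by rewrite ge_min lexx orbT.
by split; apply/andP; split; lra.
Qed.

(** With X = Y along [v] the [w] component is zero, so the dust equations retain only the [nu] term,
    which the vacuum condition equates to 0; X = Y along [w] isolates the [nub] term. Only [v != w]
    matters, so both conventions are covered. *)
Lemma radial_mass_zero kappa v w e' e : 0 < kappa -> 0 < e' -> 0 < e ->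
  (v, w) = (iu, iub) \/ (v, w) = (iub, iu) ->
  weak_vacuum us ubs m j -> dust_equations us ubs m j nu nub kappa v w ->
  let F := fun (_ : bool) (p : pt R) =>
    (cutoff us e' (uof p) * cutoff ubs e (ubof p)) ^+ 2 in
  int_nu us m nu kappa F = 0 /\ int_nub ubs m nub kappa F = 0.
Proof.
move=> k0 e'0 e0 vw vac [dust _] F.
have int_nu0 : int_nu us m nu kappa (fun _ _ => 0) = 0.
  rewrite /int_nu (@eq_Rintegral _ _ _ _ _ (fun=> 0)) => [|u _].
    by rewrite /Rintegral integral0 mulr0.
  rewrite -[RHS](intC0 (nu u)); congr intC.
  by do 3!apply/funext => ?; rewrite mul0r.
have int_nub0 : int_nub ubs m nub kappa (fun _ _ => 0) = 0.
  rewrite /int_nub (@eq_Rintegral _ _ _ _ _ (fun=> 0)) => [|u _].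
    by rewrite /Rintegral integral0 mulr0.
  rewrite -[RHS](intC0 (nub u)); congr intC.
  by do 3!apply/funext => ?; rewrite mul0r.
have radial a b :
    (fun c p => radial_field a e' e c p b * radial_field a e' e c p b) =
    if b == a then F else (fun _ _ => 0).
  apply/funext => c; apply/funext => p; rewrite /radial_field.
  by case: (b == a); rewrite ?mulr0.
have [vI wI vNw] : [/\ v = iu \/ v = iub, w = iu \/ w = iub & v != w].
  by case: vw => -[-> ->]; split=> //; [left|right|right|left].
have tv := test_radial_field e'0 e0 vI.
have tw := test_radial_field e'0 e0 wI.
split.
- have := dust _ _ tv tv; rewrite (vac _ _ tv tv) (radial v v) (radial v w) eqxx.
  rewrite [w == v]eq_sym (negPf vNw) int_nub0 addr0.
  by move=> <-.
- have := dust _ _ tw tw; rewrite (vac _ _ tw tw) (radial w v) (radial w w) eqxx.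
  rewrite (negPf vNw) int_nu0 add0r.
  by move=> <-.
Qed.

End NullDustMeasures.

(** * The equivalence of a vacuum limit with vanishing initial measures *)

Theorem corollary1p11 (R : realType) (I Ib : R) (D0 : R)
    (gring : bool -> plane R -> cot R)
    (data : nat -> chardata R)
    (us ubs : R) (gn : nat -> dnmetric R) (nk : nat -> nat)
    (ginf : dnmetric R) (jinf : dnjet R)
    (nu nub : R -> {measure set (cylinder R) -> \bar R})
    (kappa : R) (v w : 'I_4)
    (I_gt0 : 0 < I) (Ib_gt0 : 0 < Ib)
    (gring_metric : smooth_S_metric gring)
    (data_char : forall n, full_characteristic_data I Ib (data n))
    (data_shift : forall n c s x A, 0 <= s <= I -> hshf (onHb (data n)) c s x A = 0)
    (data_UB : forall n, uniform_bounds I Ib D0 gring (data n))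
    (data_S00 : exists g0,
       C3_converges (fun n c x => hgam (onH (data n)) c 0 x) g0)
    (us_bnd : 0 < us <= I) (ubs_bnd : 0 < ubs <= Ib)
    (gn_vacuum : forall n, vacuum_solution us ubs (data n) (gn n))
    (nk_incr : forall k, (nk k < nk k.+1)%N)
    (ginf_metric : weak_metric us ubs ginf jinf)
    (ginf_sliced : sliced_jet us ubs ginf jinf)
    (cvg_C0 : C0_converges us ubs (fun k => gn (nk k)) ginf)
    (cvg_W12 : derivatives_converge us ubs (fun k => gn (nk k)) jinf)
    (cvg_ricci :
       ricci_coefficients_converge us ubs (fun k => gn (nk k)) ginf jinf)
    (nu_radon : radon_family ubs us nu) (nub_radon : radon_family us ubs nub)
    (nu_limits : weak_star_limits us ubs (fun k => gn (nk k)) ginf jinf nu nub)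
    (kappa_gt0 : 0 < kappa) (vw : (v, w) = (iu, iub) \/ (v, w) = (iub, iu))
    (dust : weak_null_dust us ubs ginf jinf nu nub kappa v w) :
  weak_vacuum us ubs ginf jinf
  <-> zero_measure (nu 0) /\ zero_measure (nub 0).
Proof.
have /andP[us0 _] := us_bnd; have /andP[ubs0 _] := ubs_bnd.
have [gdn _ glap _] := ginf_metric.
have [duste trn trnb] := dust.
have [c [C [c0 C0 cC]]] := lap_sqr_bounds (ltW us0) (ltW ubs0) gdn
  (fun c => (glap c).1).
have nu_out u : 0 <= u <= us -> nu u (outside_cylinder ubs) = 0%E.
  by move=> /nu_radon.1[].
have nub_out ub : 0 <= ub <= ubs -> nub ub (outside_cylinder us) = 0%E.
  by move=> /nub_radon.1[].
have nu_fin u e : 0 <= u <= us -> 0 < e ->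
    (\int[nu u]_q (cutoff ubs e q.1 ^+ 2)%:E < +oo)%E.
  by move=> /nu_radon.1[_ fin] e0; apply: integral_cutoff_sqr_lty; exact: fin.
have nub_fin ub e : 0 <= ub <= ubs -> 0 < e ->
    (\int[nub ub]_q (cutoff us e q.1 ^+ 2)%:E < +oo)%E.
  by move=> /nub_radon.1[_ fin] e0; apply: integral_cutoff_sqr_lty; exact: fin.
have us00 : (0 : R) <= 0 <= us by apply/andP; split=> //; exact: ltW.
have ubs00 : (0 : R) <= 0 <= ubs by apply/andP; split=> //; exact: ltW.
split=> [vac|[nu0 nub0] X Y tX tY]; last first.
  (* Every cutoff mass of [nu u] equals that of [nu 0], which is 0, and these masses detect the
     whole measure. *)
  have nuz u : 0 <= u <= us -> zero_measure (nu u).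
    move=> ui; apply: zero_measure_cutoff (nu_out _ ui) (nu_radon.1 _ ui).2 _.
    move=> e e0; rewrite (transport_nu_cutoff trn e0 ui).
    exact: Rintegral_zero_measure nu0.
  have nubz ub : 0 <= ub <= ubs -> zero_measure (nub ub).
    move=> ui; apply: zero_measure_cutoff (nub_out _ ui) (nub_radon.1 _ ui).2 _.
    move=> e e0; rewrite (transport_nub_cutoff trnb e0 ui).
    exact: Rintegral_zero_measure nub0.
  have int_nu0 F : int_nu us ginf nu kappa F = 0.
    rewrite /int_nu (@eq_Rintegral _ _ _ _ _ (fun=> 0)) => [|u /set_mem/=].
      by rewrite /Rintegral integral0 mulr0.
    by rewrite in_itv/= => /nuz nuu0; exact: Rintegral_zero_measure nuu0.
  have int_nub0 F : int_nub ubs ginf nub kappa F = 0.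
    rewrite /int_nub (@eq_Rintegral _ _ _ _ _ (fun=> 0)) => [|ub /set_mem/=].
      by rewrite /Rintegral integral0 mulr0.
    by rewrite in_itv/= => /nubz nubub0; exact: Rintegral_zero_measure nubub0.
  by rewrite (duste.1 _ _ tX tY) int_nu0 int_nub0 addr0.
have kappa_neq0 : kappa != 0 by rewrite gt_eqF.
(* Any margin below half the side keeps the averaging cutoff from vanishing identically; a quarter
   is chosen. The margin [e] in the other variable stays arbitrary, as [zero_measure_cutoff]
   requires. *)
have usq : 0 < us / 4 by rewrite divr_gt0.
have ubsq : 0 < ubs / 4 by rewrite divr_gt0.
split.
- apply: zero_measure_cutoff (nu_out _ us00) (nu_radon.1 _ us00).2 _ => e e0.
  apply: (@weighted_family_zero _ ubs us (us / 4) c C _ nu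
    (fun t => cutoff ubs e t ^+ 2)
    (fun u ub ch x => lap ginf ch (mk u ub x) ^+ 2)) => //; first lra.
  + by move=> t; apply: cvgM; exact: continuous_cutoff.
  + by move=> t; exact: sqr_ge0.
  + by move=> u ui; exact: nu_fin.
  + by move=> u ui; rewrite (transport_nu_cutoff trn e0 ui).
  + by move=> u ub ch x; exact: sqr_ge0.
  + by move=> u ub ch x ui /andP[ub0 ub1]; apply: cC => //; rewrite !ltW.
  have [+ _] := radial_mass_zero kappa_gt0 usq e0 vw vac duste.
  move=> /eqP; rewrite /int_nu mulf_eq0 (negPf kappa_neq0)/= => /eqP mass0.
  rewrite -[RHS]mass0.
  apply: eq_Rintegral => u _; congr intC.
  by apply/funext => ub; apply/funext => ch; apply/funext => x; rewrite -exprMn.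
- apply: zero_measure_cutoff (nub_out _ ubs00) (nub_radon.1 _ ubs00).2 _ => e e0.
  apply: (@weighted_family_zero _ us ubs (ubs / 4) c C _ nub
    (fun t => cutoff us e t ^+ 2)
    (fun ub u ch x => lap ginf ch (mk u ub x) ^+ 2)) => //; first lra.
  + by move=> t; apply: cvgM; exact: continuous_cutoff.
  + by move=> t; exact: sqr_ge0.
  + by move=> ub ui; exact: nub_fin.
  + by move=> ub ui; rewrite (transport_nub_cutoff trnb e0 ui).
  + by move=> ub u ch x; exact: sqr_ge0.
  + by move=> ub u ch x ui /andP[u0 u1]; apply: cC => //; rewrite !ltW.
  (* The margins exchange roles: u now carries the arbitrary [e], while ubar, the averaging
     variable, carries [ubs / 4]. *)
  have [_ +] := radial_mass_zero kappa_gt0 e0 ubsq vw vac duste.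
  move=> /eqP; rewrite /int_nub mulf_eq0 (negPf kappa_neq0)/= => /eqP mass0.
  rewrite -[RHS]mass0.
  apply: eq_Rintegral => ub _; congr intC; apply/funext => u; apply/funext => ch.
  by apply/funext => x; rewrite -exprMn [X in X ^+ 2 * _ = _]mulrC.
Qed.
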